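(* Let $q=(q_1,\dots,q_m)$ be a minimal set of homogeneous generators of an ideal of codimension $r\geq 2$ in $k[z_1,\dots,z_r]$ such that $\deg(q_i)=2$ for all $i$ and the first syzygy matrix of the ideal $(q_1,\dots,q_m)$ is linear. Then the ideal of $q$-relations $\mathcal{I}_q$ is generated by quadratic polynomials. Furthermore, if $q'$ is obtained from $q$ by a linear change of variables, then $\mathcal{I}_q\cong\mathcal{I}_{q'}$.
   Context: $k$ is an algebraically closed field of characteristic $0$. Ideal of $q$-relations. Let $\overline{S}=k[z_1,\dots,z_r]$ and let $q=(q_1,\dots,q_m)$ be homogeneous generators of an ideal such that $\overline{R}=\overline{S}/(q_1,\dots,q_m)$ is a zero-dimensional $k$-algebra. Consider $$f_i:=q_i-\sum_{j} c_{ij}\,\overline{z}^{\,j}\,z_0^{\deg q_i-\sum_k j_k},\qquad \overline{z}^{\,j}=z_1^{j_1}\cdots z_r^{j_r},$$ where $j\in\mathbb{N}^r$ runs over multi-indices with $\sum_k j_k<\deg q_i$, $z_0$ is a new variable of degree $1$, and the $c_{ij}$ are indeterminate coefficients. The ideal of $q$-relations $\mathcal{I}_q\subset k[c_{ij}]$ is the ideal generated by the relations between the $c_{ij}$ which make $R=\overline{S}[z_0]/\langle f_i\rangle$ a flat deformation of $\overline{R}$, i.e. such that $z_0$ is a non-zero-divisor in $R$ and $R/(z_0)=\overline{R}$. When all $q_i$ are quadratic and the first syzygy matrix $l$ (an $m\times n_2$ matrix) of $q$ is linear, write $f_i=q_i-\left(\sum_{j=1}^r c_{ij}z_j\right)z_0-d_iz_0^2$.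 Let $\overline z=(z_1,\dots,z_r)$, let $C$ be the $r\times m$ matrix of the coefficients $c_{ij}$ (so that the $i$-th entry of $\overline zC$ is $\sum_jc_{ij}z_j$), let $D=(d_1,\dots,d_m)$, and let $N=(n_{ij})$ be an $m\times n_2$ matrix of indeterminates. The relations defining $\mathcal{I}_q$ are those making $$(q-\overline{z}\,C z_0-Dz_0^2)(l+Nz_0)=0$$ hold, coefficient by coefficient in $z_0$: $qN-(\overline zC)l=0$ gives linear equations expressing each $n_{ij}$ in terms of the $c_{ij}$, and possibly linear relations among the $c_{ij}$; $\overline zCN+Dl=0$ (together with the linear equations) gives $d_i=h_i(c_{ij})$ with $h_i$ quadratic polynomials, and quadratic relations among the $c_{ij}$; $DN=0$ gives cubic relations. Since the $d_i$ are determined by the $c_{ij}$, $\mathcal{I}_q$ is regarded as the ideal of relations between the $c_{ij}$, where the linear relations coming from the coefficient of $z_0$ are used to eliminate variables. *)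

(* Defs.v *)
From HB Require Import structures.
From Stdlib Require Import Classical.
From mathcomp Require Import all_boot all_order all_algebra.
From mathcomp Require Export mpoly.

Set Implicit Arguments.
Unset Strict Implicit.
Unset Printing Implicit Defensive.

Import GRing.Theory.
Local Open Scope ring_scope.

(* Ideals of a commutative ring are [Prop]-valued predicates: MathComp's
   [idealr] structures are boolean, hence restricted to decidable ideals. *)
Section Ideals.
Variable R : comNzRingType.
Implicit Types (G I P Q : R -> Prop).

Definition ideal_gen G (p : R) : Prop :=
  exists (n : nat) (a g : 'I_n -> R),
    (forall i, G (g i)) /\ p = \sum_(i < n) a i * g i.

Definition ideal_of_row (m : nat) (q : 'rV[R]_m) : R -> Prop :=
  ideal_gen (fun g => exists i, g = q 0 i).

Definition is_ideal I : Prop :=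
  [/\ I 0, forall x y, I x -> I y -> I (x + y) & forall a x, I x -> I (a * x)].

Definition is_prime_ideal P : Prop :=
  [/\ is_ideal P, ~ P 1 & forall x y, P (x * y) -> P x \/ P y].

Definition ideal_sub P Q : Prop := forall x, P x -> Q x.

Definition height_ge P (h : nat) : Prop :=
  exists c : nat -> R -> Prop,
    [/\ forall i, (i <= h)%N -> is_prime_ideal (c i),
        forall i, (i < h)%N -> ideal_sub (c i) (c i.+1) /\
                               exists x, c i.+1 x /\ ~ c i x
      & forall x, c h x <-> P x].

(* The codimension (height) of an ideal is the least height of a prime
   containing it; the existence clause forces the ideal to be proper. *)
Definition codimension I (h : nat) : Prop :=
  (forall P, is_prime_ideal P -> ideal_sub I P -> height_ge P h) /\
  (exists P, [/\ is_prime_ideal P, ideal_sub I P & ~ height_ge P h.+1]).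

Definition minimal_generators (m : nat) (q : 'rV[R]_m) : Prop :=
  forall i, ~ ideal_gen (fun g => exists2 j, j != i & g = q 0 j) (q 0 i).

Definition generates_syzygies (m n : nat) (q : 'rV[R]_m) (l : 'M[R]_(m, n)) :=
  forall u : 'cV[R]_m, q *m u = 0 <-> exists a : 'cV[R]_n, u = l *m a.

Definition minimal_columns (m n : nat) (l : 'M[R]_(m, n)) : Prop :=
  forall j, ~ exists2 a : 'cV[R]_n, a j 0 = 0 & col j l = l *m a.

End Ideals.

(* Isomorphism of ideals of polynomial rings: an isomorphism of the ambient
   k-algebras carrying one ideal onto the other. *)
Definition ideal_iso (k : fieldType) (s t : nat)
    (I : {mpoly k[s]} -> Prop) (J : {mpoly k[t]} -> Prop) : Prop :=
  exists f : {lrmorphism {mpoly k[s]} -> {mpoly k[t]}},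
    bijective f /\ forall p, I p <-> J (f p).

Definition generated_by_quadrics (k : fieldType) (s : nat)
    (I : {mpoly k[s]} -> Prop) : Prop :=
  exists G : {mpoly k[s]} -> Prop,
    (forall g, G g -> g \is 2.-homog) /\ (forall p, I p <-> ideal_gen G p).

Section QRelations.
Variables (k : fieldType) (r m n : nat).

Definition linear_first_syzygy_matrix
    (q : 'rV[{mpoly k[r]}]_m) (l : 'M[{mpoly k[r]}]_(m, n)) : Prop :=
  [/\ generates_syzygies q l, minimal_columns l
    & forall i j, l i j \is 1.-homog].

(* The entries of [q] after the substitution z_i := \sum_j A_ij z_j. *)
Definition linear_change (A : 'M[k]_r) (q : 'rV[{mpoly k[r]}]_m) :=
  map_mx (fun p => p \mPo [tuple \sum_(j < r) A i j *: 'X_j | i < r]) q.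

(* The r * m indeterminates c_ij come first (c_ij is the one of index
   [mxvec_index i j]), then the m indeterminates d_i, then the m * n
   indeterminates n_ij. *)
Definition nvars : nat := (m * r + (m + m * n))%N.

Definition cvar (v : 'I_(m * r)) : {mpoly k[nvars]} := 'X_(lshift _ v).
Definition Cmx : 'M[{mpoly k[nvars]}]_(r, m) :=
  \matrix_(j, i) cvar (mxvec_index i j).
Definition Dmx : 'rV[{mpoly k[nvars]}]_m :=
  \row_i 'X_(rshift _ (lshift _ i)).
Definition Nmx : 'M[{mpoly k[nvars]}]_(m, n) :=
  \matrix_(i, j) 'X_(rshift _ (rshift _ (mxvec_index i j))).

(* k[c, d, n][z_1, ..., z_r][z_0]; the outer variable is z_0. *)
Local Notation ambient := {poly {mpoly {mpoly k[nvars]}[r]}}.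

Definition of_z (p : {mpoly k[r]}) : ambient :=
  (map_mpoly (@mpolyC nvars k) p)%:P.
Definition of_coef (a : {mpoly k[nvars]}) : ambient := (a%:MP)%:P.
Definition zrow : 'rV[ambient]_r := \row_j ('X_j)%:P.

Variables (q : 'rV[{mpoly k[r]}]_m) (l : 'M[{mpoly k[r]}]_(m, n)).

(* (q - z C z_0 - D z_0^2) (l + N z_0) *)
Definition deformed_product : 'rV[ambient]_n :=
  (map_mx of_z q - 'X *: (zrow *m map_mx of_coef Cmx)
     - 'X ^+ 2 *: map_mx of_coef Dmx)
  *m (map_mx of_z l + 'X *: map_mx of_coef Nmx).

Definition relation (e : nat) (p : {mpoly k[nvars]}) : Prop :=
  exists (j : 'I_n) (mon : 'X_{1..r}), p = ((deformed_product 0 j)`_e)@_mon.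

Definition embed_c (p : {mpoly k[m * r]}) : {mpoly k[nvars]} :=
  p \mPo [tuple cvar v | v < m * r].

(* The d_i and n_ij are eliminated by contraction to k[c]. *)
Definition q_relations (p : {mpoly k[m * r]}) : Prop :=
  ideal_gen (fun g => exists e, relation e g) (embed_c p).

Definition linear_relation (p : {mpoly k[m * r]}) : Prop :=
  p \is 1.-homog /\ ideal_gen (relation 1) (embed_c p).

(* Elimination of variables by means of the linear relations: the c's indexed
   by the range of [kept] are renamed 'X_0, ..., 'X_(s-1), every other c is
   replaced by a linear form in these, and the linear forms killed by the
   substitution are exactly the linear relations. *)
Definition linear_elimination (s : nat) (kept : 'I_s -> 'I_(m * r))
    (sub : (m * r).-tuple {mpoly k[s]}) : Prop :=
  [/\ forall v, tnth sub v \is 1.-homog,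
      forall t, tnth sub (kept t) = 'X_t
    & forall p, p \is 1.-homog -> (p \mPo sub = 0 <-> linear_relation p)].

Definition reduced_q_relations (s : nat) (sub : (m * r).-tuple {mpoly k[s]})
    (p : {mpoly k[s]}) : Prop :=
  exists2 p0, q_relations p0 & p = p0 \mPo sub.

End QRelations.

Lemma ideal_gen0 (R : comNzRingType) (G : R -> Prop) : ideal_gen G 0.
Proof. by exists 0%N, (fun=> 0), (fun=> 0); split; [case | rewrite big_ord0]. Qed.

Lemma ideal_genD (R : comNzRingType) (G : R -> Prop) x y :
  ideal_gen G x -> ideal_gen G y -> ideal_gen G (x + y).
Proof.
move=> [n1 [a1 [g1 [G1 ->]]]] [n2 [a2 [g2 [G2 ->]]]].
pose pr (u1 : 'I_n1 -> R) u2 (i : 'I_(n1 + n2)) :=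
  match split i with inl j => u1 j | inr j => u2 j end.
exists (n1 + n2)%N, (pr a1 a2), (pr g1 g2); split=> [i|].
  by rewrite /pr; case: split.
rewrite big_split_ord /=; congr (_ + _); apply: eq_bigr => i _.
  by rewrite /pr (unsplitK (inl i)).
by rewrite /pr (unsplitK (inr i)).
Qed.

Lemma ideal_genM (R : comNzRingType) (G : R -> Prop) a x :
  ideal_gen G x -> ideal_gen G (a * x).
Proof.
move=> [n [b [g [Gg ->]]]]; exists n, (fun i => a * b i), g; split=> //.
by rewrite mulr_sumr; apply: eq_bigr => i _; rewrite mulrA.
Qed.

(* Every space of linear forms can be used to eliminate variables. *)
Section Elimination.
Variables (k : fieldType) (N : nat) (W : {mpoly k[N]} -> Prop).
Hypotheses (W1 : forall p, W p -> p \is 1.-homog) (W0 : W 0).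
Hypotheses (WD : forall x y, W x -> W y -> W (x + y)).
Hypotheses (WZ : forall (a : k) x, W x -> W (a *: x)).

Let free (E : {set 'I_N}) := forall a : 'I_N -> k,
  W (\sum_(t in E) a t *: 'X_t) -> forall t, t \in E -> a t = 0.

Lemma max_free : exists E, free E /\ forall v, v \notin E -> ~ free (v |: E).
Proof.
suff H : forall d E, free E -> (N - #|E| <= d)%N ->
   exists E, free E /\ forall v, v \notin E -> ~ free (v |: E).
  by apply: (H _ set0 _ (leqnn _)) => a _ t; rewrite inE.
elim=> [|d IH] E fE hE.
  exists E; split=> // v vE; move: hE; rewrite leqn0 subn_eq0 => hE.
  have := max_card (v |: E); rewrite cardsU1 vE card_ord add1n => h.
  by have := leq_trans h hE; rewrite ltnn.
have [[v [vE fv]]|no] := classic (exists v, v \notin E /\ free (v |: E)).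
  apply: (IH _ fv); rewrite cardsU1 vE add1n subnS.
  by case: (N - _)%N hE.
by exists E; split=> // v vE fv; apply: no; exists v.
Qed.

Lemma WB x y : W x -> W y -> W (x - y).
Proof. by move=> hx hy; rewrite -scaleN1r; apply/WD/WZ. Qed.

Lemma Wsum (I : finType) (F : I -> {mpoly k[N]}) :
  (forall i, W (F i)) -> W (\sum_i F i).
Proof. by move=> h; apply: big_ind. Qed.

Lemma homog1E (p : {mpoly k[N]}) :
  p \is 1.-homog -> p = \sum_v p@_U_(v) *: 'X_v.
Proof.
move=> hp; apply/mpolyP=> m; rewrite raddf_sum /=.
have [/mdeg1P [v /eqP ->] | dm] := boolP (mdeg m == 1%N).
  rewrite (bigD1 v) //= big1 ?addr0 => [|w wv].
    by rewrite mcoeffZ mcoeffX eqxx mulr1.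
  rewrite mcoeffZ mcoeffX; case: eqP => [/eqP|_]; last by rewrite mulr0.
  by rewrite eq_mnm1 (negPf wv).
rewrite (dhomog_nemf_coeff hp dm) big1 // => v _.
rewrite mcoeffZ mcoeffX; case: eqP => [h|_]; last by rewrite mulr0.
by move: dm; rewrite -h mdeg1.
Qed.

Lemma linear_forms_elimination : exists s (kept : 'I_s -> 'I_N) (sub : N.-tuple {mpoly k[s]}),
  [/\ forall v, tnth sub v \is 1.-homog,
      forall t, tnth sub (kept t) = 'X_t
    & forall p, p \is 1.-homog -> (p \mPo sub = 0 <-> W p)].
Proof.
have [E [fE mE]] := max_free.
have fE' (b : 'I_#|E| -> k) :
    W (\sum_t b t *: 'X_(enum_val t)) -> forall t, b t = 0.
  move=> hb t.
  pose b' v := if [pick u : 'I_#|E| | enum_val u == v] is Some u then b u else 0.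
  have b'E u : b' (enum_val u) = b u.
    rewrite /b'; case: pickP => [u' /eqP /enum_val_inj -> //|/(_ u)].
    by rewrite eqxx.
  rewrite -b'E; apply: (fE b' _ _ (enum_valP t)).
  by rewrite big_enum_val; under eq_bigr => u _ do rewrite b'E.
have red v : exists a : {ffun 'I_#|E| -> k},
    W ('X_v - \sum_t a t *: 'X_(enum_val t)).
  have [vE|vE] := boolP (v \in E).
    have [t0 ht0] : exists t : 'I_#|E|, enum_val t = v.
      by exists (enum_rank_in vE v); rewrite enum_rankK_in.
    exists [ffun t => (t == t0)%:R].
    rewrite (bigD1 t0) //= big1 => [|t /negPf tv]; rewrite ffunE.
      by rewrite eqxx scale1r addr0 ht0 subrr.
    by rewrite tv scale0r.
  have /not_all_ex_not [a /not_all_ex_not [Wa /not_all_ex_not [t nt]]] := mE v vE.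
  move: Wa; rewrite big_setU1 //= => Wa.
  have av : a v != 0.
    apply/eqP=> av0; apply: nt => tE; move: Wa; rewrite av0 scale0r add0r => Wa.
    by move: tE; rewrite inE => /orP [/set1P -> //|tE]; exact: (fE _ Wa).
  exists [ffun t => - (a v)^-1 * a (enum_val t)].
  move: (WZ (a v)^-1 Wa); rewrite scalerDr scalerA mulVf // scale1r.
  rewrite big_enum_val scaler_sumr -sumrN.
  congr (W (_ + _)); apply: eq_bigr => t' _.
  by rewrite ffunE scalerA mulNr scaleNr opprK.
have [a ha] := fin_all_exists red.
pose sub : N.-tuple {mpoly k[#|E|]} := [tuple \sum_t a v t *: 'X_t | v < N].
have keptE t : tnth sub (enum_val t) = 'X_t.
  rewrite tnth_mktuple.
  have bE : W (\sum_u ((u == t)%:R - a (enum_val t) u) *: 'X_(enum_val u)).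
    have := ha (enum_val t); congr W.
    under [RHS]eq_bigr => u _ do rewrite scalerBl.
    rewrite sumrB; congr (_ - _); rewrite (bigD1 t) //= eqxx scale1r big1 ?addr0 //.
    by move=> i /negPf ->; rewrite scale0r.
  rewrite (bigD1 t) //= big1 => [|u /negPf ut].
    by have /eqP := fE' _ bE t; rewrite eqxx subr_eq0 => /eqP <-; rewrite scale1r addr0.
  by have /eqP := fE' _ bE u; rewrite ut subr_eq0 => /eqP <-; rewrite scale0r.
exists #|E|, (fun t => enum_val t), sub; split=> // [v|p hp].
  rewrite tnth_mktuple; apply: rpred_sum => t _; apply: rpredZ.
  by rewrite dhomogX /= mdeg1.
pose cf t := \sum_v p@_U_(v) * a v t.
have subE : p \mPo sub = \sum_t cf t *: 'X_t.
  rewrite {1}(homog1E hp) raddf_sum /=.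
  under eq_bigr => v _ do
    rewrite comp_mpolyZ comp_mpolyXU -tnth_nth tnth_mktuple scaler_sumr.
  rewrite exchange_big; apply: eq_bigr => t _; rewrite scaler_suml.
  by apply: eq_bigr => v _; rewrite scalerA.
have Wp : W (p - \sum_t cf t *: 'X_(enum_val t)).
  rewrite {1}(homog1E hp).
  have -> : \sum_t cf t *: 'X_(enum_val t) =
     \sum_v p@_U_(v) *: \sum_t a v t *: 'X_(enum_val t).
    under [RHS]eq_bigr => v _ do rewrite scaler_sumr.
    rewrite exchange_big; apply: eq_bigr => t _; rewrite scaler_suml.
    by apply: eq_bigr => v _; rewrite scalerA.
  by rewrite -sumrB; apply: Wsum => v; rewrite -scalerBr; apply: WZ.
rewrite subE; split=> [s0|hW].
  have cf0 t : cf t = 0.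
    have := congr1 (fun P => P@_U_(t)) s0; rewrite raddf_sum /= mcoeff0.
    rewrite (bigD1 t) //= big1 => [|t' tt']; last first.
      by rewrite mcoeffZ mcoeffX eq_mnm1 (negPf tt') mulr0.
    by rewrite mcoeffZ mcoeffX eqxx mulr1 addr0.
  by move: Wp; rewrite big1 ?subr0 // => t _; rewrite cf0 scale0r.
have := WB hW Wp; rewrite subKr => hc.
by rewrite big1 // => t _; rewrite (fE' _ hc) scale0r.
Qed.
End Elimination.

Lemma linear_elimination_exists (k : fieldType) (r m n : nat)
    (q : 'rV[{mpoly k[r]}]_m) (l : 'M[{mpoly k[r]}]_(m, n)) :
  exists (s : nat) (kept : 'I_s -> 'I_(m * r))
         (sub : (m * r).-tuple {mpoly k[s]}), linear_elimination q l kept sub.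
Proof.
apply: linear_forms_elimination.
- by split; [exact: rpred0 | rewrite /embed_c comp_mpoly0; exact: ideal_gen0].
- move=> x y [hx ix] [hy iy]; split; first exact: rpredD.
  by rewrite /embed_c raddfD; apply: ideal_genD.
move=> a x [hx ix]; split; first exact: rpredZ.
by rewrite /embed_c comp_mpolyZ -mul_mpolyC; apply: ideal_genM.
Qed.

(* Main.v *)
Require Import Defs.
From HB Require Import structures.
From Stdlib Require Import Classical ClassicalEpsilon.
From mathcomp Require Import all_boot all_order all_algebra.
From mathcomp Require Import ring.

(** Write S = k[z] and E = zC. The coefficients of z_0, z_0^2 and z_0^3 in
    (q - E z_0 - D z_0^2)(l + N z_0) are q N - E l, -(E N + D l) and -D N.
    With c and n in degree 1 and d in degree 2 they have degrees 1, 2 and 3,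
    so the first claim has two halves: the entries of D N lie in the ideal J
    generated by the other coefficients, and d and n can be eliminated with
    the help of the linear and quadratic relations.

    The cubic relations. Suppose that an entry w_j of w = D N is not in J.
    Some k-linear functional phi on k[c,d,n] kills J but not w_j
    ([normal_form]); put v = phi(w). Let a be a vector over S such that l a is
    a Koszul syzygy b q^T, with b alternating. Lifting this equality one power
    of z_0 at a time, as the linear and quadratic relations permit, exhibits
    w a as an element of (q) modulo J ([koszul_lift]), so v a lies in (q).
    Hence l a |-> v a is a well-defined S-linear map from the syzygies of q to
    S/(q) that kills the Koszul syzygies, and it sends the j-th column of l to
    the nonzero constant v_j.

    No such map exists ([obstruction_functional_eq0]), because S/(q) has finite
    projective dimension. On the algebra Tor^S(S/(q), k), computed by the Koszul
    complex of z with coefficients in S/(q), the map induces a derivation theta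
    of degree -2, and the j-th column of l gives a class u of degree 2 with
    theta(u) = v_j. As u lives in an exterior algebra on r generators, it is
    nilpotent; but theta^N(u^N) = N! v_j^N is nonzero in characteristic 0.

    Elimination. By minimality the q_i are linearly independent, so q N = E l
    modulo J expresses each n_ij as a linear form in the c's. The rows of l are
    linearly independent over k as well, because the Koszul syzygies factor
    through l; so E N + D l = 0 expresses each d_i as a quadratic form in the
    c's. Substituting these expressions turns the relations into linear and
    quadratic forms in the c's; the linear ones are killed by the elimination
    of variables and the quadratic ones generate what is left.

    Changes of variables. Replacing z by zA^T replaces C by A^T C, and
    l(Az) = l' H for a constant matrix H since both sides consist of linear
    forms. So the substitution c -> A^-T c, d -> d, n -> n H maps relations
    of q to relations of q' ([relation_change]); the change of variables by
    A^-1 gives the inverse map. *)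

Set Implicit Arguments.
Unset Strict Implicit.
Unset Printing Implicit Defensive.

Import Order.TTheory GRing.Theory.
Local Open Scope ring_scope.

(** * Exterior multiplication and contraction as matrices *)

(** The exterior algebra on r generators acts on itself, the e_s by
    multiplication and d = \sum_s z_s d/de_s by contraction. Adding a
    generator doubles the module, which gives the block matrices below.
    Working in this matrix ring replaces the exterior algebra by a ring in
    which products, scalars and entries are directly available. The last
    clause keeps the entries of d in the ideal generated by the z_s. *)
Lemma koszul_operators (R : comNzRingType) (r : nat) (z : 'I_r -> R) :
  exists (K : nat) (e : 'I_r -> 'M[R]_K) (d : 'M[R]_K),
    (0 < K)%N /\
    [/\ d *m d = 0,
        forall s, d *m e s + e s *m d = (z s)%:M,
        forall s, e s *m e s = 0,
        forall s t, e s *m e t = - (e t *m e s)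
      & forall I, is_ideal I -> (forall s, I (z s)) -> forall i j, I (d i j)].
Proof.
elim: r z => [|r IH] z.
  exists 1%N, (fun _ => 0), 0; split=> //; split; try by case.
    by rewrite mul0mx.
  by move=> I [I0 _ _] _ i j; rewrite mxE.
have [K [e [d [K0 [dd de ee eC dI]]]]] := IH (fun s => z (lift ord0 s)).
exists (K + K)%N.
exists (fun s => if unlift ord0 s is Some s'
  then block_mx (e s') 0 0 (- e s') else block_mx 0 1%:M 0 0).
exists (block_mx d 0 (z ord0)%:M (- d)); split; first by rewrite addn_gt0 K0.
split=> [|s|s|s t|I [I0 ID IM] Iz i j].
- rewrite mulmx_block !mul0mx !mulmx0 !mulNmx !mulmxN dd mul_scalar_mx.
  by rewrite mul_mx_scalar !oppr0 !addr0 subrr ?opprK ?addr0 ?add0r block_mx0.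
- case: (unliftP ord0 s) => [s' ->|->]; rewrite !mulmx_block add_block_mx;
    rewrite !mul0mx !mulmx0 !addr0 !add0r scalar_mx_block.
    by rewrite de !mulNmx !mulmxN !opprK de mul_scalar_mx mul_mx_scalar subrr.
  by rewrite !mulmx1 !mul1mx subrr.
- case: (unliftP ord0 s) => [s' _|_]; rewrite mulmx_block !mul0mx !mulmx0 !addr0.
    by rewrite !add0r mulNmx mulmxN opprK ee block_mx0.
  by rewrite block_mx0.
- case: (unliftP ord0 s) => [s' _|_]; case: (unliftP ord0 t) => [t' _|_];
    rewrite !mulmx_block opp_block_mx !mul0mx !mulmx0 !addr0 ?add0r
      ?mulmx1 ?mul1mx ?oppr0 ?opprK //.
  by rewrite !mulmxN !mulNmx !opprK -eC.
have Iopp x : I x -> I (- x) by move=> Ix; rewrite -mulN1r; exact: IM.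
have dI' : forall i j, I (d i j) by apply: dI.
case: (split_ordP i) => i' ->; case: (split_ordP j) => j' ->.
- by rewrite block_mxEul; exact: dI'.
- by rewrite block_mxEur mxE.
- by rewrite block_mxEdl mxE; case: (_ == _); rewrite ?mulr1n ?mulr0n.
- by rewrite block_mxEdr mxE; apply: Iopp; exact: dI'.
Qed.

Lemma nilpotent_sum (R : nzRingType) (I : Type) (s : seq I) (x : I -> R) :
  (forall i, x i * x i = 0) -> (forall i j, GRing.comm (x i) (x j)) ->
  exists N, (\sum_(i <- s) x i) ^+ N = 0.
Proof.
move=> xx xC; elim: s => [|i s [N hN]].
  by exists 1%N; rewrite big_nil expr1.
exists N.+1; rewrite big_cons; set y := \sum_(j <- s) x j.
have cxy : GRing.comm (x i) y by apply: commr_sum => j _.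
rewrite addrC exprDn_comm; last exact: commr_sym.
rewrite big1 // => -[[|[|k]] hk] _ /=.
- by rewrite ?subn0 exprS hN mulr0 mul0r mul0rn.
- by rewrite ?subSS ?subn0 hN mul0r mul0rn.
- have -> : x i ^+ k.+2 = 0 by rewrite exprS exprS mulrA xx mul0r.
  by rewrite mulr0 mul0rn.
Qed.

(** * There is no derivation of degree -2 *)

Lemma natr_neq0 (k : fieldType) (N : nat) :
  [pchar k] =i pred0 -> N.+1%:R != 0 :> k.
Proof. by move=> /pcharf0P ->. Qed.

Lemma euler_identity (R : comNzRingType) (r d : nat) (g : {mpoly R[r]}) :
  g \is d.-homog -> \sum_s 'X_s * g^`M(s) = g *+ d.
Proof.
move=> hg; rewrite {1 2}[g]mpolyE.
under eq_bigr => s _ do rewrite raddf_sum mulr_sumr.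
rewrite exchange_big -sumrMnl; apply: eq_big_seq => mon hmon /=.
have <- : mdeg mon = d := dhomog_mf hg hmon.
rewrite mdegE -sumrMnr; apply: eq_bigr => s _.
rewrite mderivZ mderivX -!scalerAr scalerMnr -scaler_nat; congr (_ *: _).
have [->|s0] := posnP (mon s); first by rewrite !scale0r.
by rewrite -mpolyXD addmC submK // lep1mP -lt0n.
Qed.

(** The Koszul complex of z is exact in degree 1; for quadrics Euler's
    identity yields the explicit primitive h_st = (1/3) dg_t/dz_s. *)
Lemma koszul_primitive (k : fieldType) (r : nat) (g : 'I_r -> {mpoly k[r]}) :
  [pchar k] =i pred0 -> (forall s, g s \is 2.-homog) ->
  \sum_s 'X_s * g s = 0 ->
  exists h : 'I_r -> 'I_r -> {mpoly k[r]},
    forall t, \sum_s 'X_s * (h s t - h t s) = g t.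
Proof.
move=> char0 hg g0.
have k3 : 3%:R != 0 :> k by apply: natr_neq0.
exists (fun s t => 3%:R^-1 *: (g t)^`M(s)) => t.
under eq_bigr => s _ do rewrite mulrBr -!scalerAr.
rewrite sumrB -!scaler_sumr (euler_identity (hg t)).
have : (\sum_s 'X_s * g s)^`M(t) = 0 by rewrite g0 raddf0.
rewrite raddf_sum /=; under eq_bigr => s _ do rewrite mderivM mderivX.
rewrite big_split /= (bigD1 t) //= big1 ?addr0 => [|s st]; last first.
  by rewrite mnm1E (negPf st) scale0r mul0r.
rewrite mnm1E eqxx scale1r.
have -> : (U_(t) - U_(t))%MM = 0%MM :> 'X_{1..r}.
  by apply/mnmP => i; rewrite mnmBE subnn mnm0E.
rewrite mpolyX0 mul1r => /eqP; rewrite addr_eq0 => /eqP e.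
rewrite -scalerBr -[X in _ - X]opprK -e opprK -mulrSr.
by rewrite -scaler_nat scalerA mulVf // scale1r.
Qed.

Lemma comm_scale (R : comNzRingType) (T : algType R) (a b : R) (x y : T) :
  GRing.comm x y -> GRing.comm (a *: x) (b *: y).
Proof.
by rewrite /GRing.comm -!scalerAl -!scalerAr !scalerA mulrC => ->.
Qed.

Section Rigidity.
Variables (k : fieldType) (r m n : nat).
Variables (q : 'rV[{mpoly k[r]}]_m) (l : 'M[{mpoly k[r]}]_(m, n)).
Hypothesis char0 : [pchar k] =i pred0.
Hypothesis q2 : forall i, q 0 i \is 2.-homog.
Hypothesis l1 : forall i j, l i j \is 1.-homog.
Hypothesis lsyz : generates_syzygies q l.
Variables (v : 'rV[k]_n).
Hypothesis vK : forall (a : 'cV[{mpoly k[r]}]_n) (c : 'M_m),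
  l *m a = (c - c^T) *m q^T ->
  exists x : 'cV_m, map_mx (@mpolyC r k) v *m a = q *m x.

Local Notation S := {mpoly k[r]}.

Lemma mul_syzygies : q *m l = 0.
Proof.
apply/matrixP => i j; rewrite !ord1 [RHS]mxE.
have /lsyz : exists a, l *m (delta_mx j 0 : 'cV_n) = l *m a by exists (delta_mx j 0).
by move/matrixP/(_ 0 0); rewrite mulmxA -colE mxE => ->; rewrite mxE.
Qed.

Section Descent.
Variables (K : nat) (e : 'I_r -> 'M[S]_K.+1) (d : 'M[S]_K.+1) (j0 : 'I_n).
Hypothesis dd : d * d = 0.
Hypothesis de : forall s, d * e s + e s * d = ('X_s)%:A.
Hypothesis ee : forall s, e s * e s = 0.
Hypothesis eC : forall s t, e s * e t = - (e t * e s).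

Let Dm x := d * x - x * d.
Let Dp x := d * x + x * d.

(** [Dm] and [Dp] are the graded commutators with d, on even and on odd
    elements: both are the Koszul differential and compose to 0. *)
Lemma DmDp x : Dm (Dp x) = 0.
Proof.
by rewrite /Dm /Dp mulrDr mulrDl !mulrA dd mul0r add0r -[x * d * d]mulrA dd mulr0 addr0 subrr.
Qed.

Lemma DpDm x : Dp (Dm x) = 0.
Proof.
rewrite /Dm /Dp mulrBr mulrBl !mulrA dd mul0r sub0r -[x * d * d]mulrA dd mulr0 subr0.
by rewrite addNr.
Qed.

Lemma DmM x y : Dm (x * y) = Dm x * y + x * Dm y.
Proof. by rewrite /Dm mulrBl mulrBr !mulrA addrA subrK. Qed.

Lemma DpM x y : Dp (x * y) = Dm x * y + x * Dp y.
Proof. by rewrite /Dm /Dp mulrBl mulrDr !mulrA addrA subrK. Qed.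

Lemma Dp_sum (I : finType) (c : I -> S) (x : I -> 'M[S]_K.+1) :
  Dp (\sum_i c i *: x i) = \sum_i c i *: Dp (x i).
Proof.
rewrite /Dp mulr_sumr mulr_suml -big_split; apply: eq_bigr => i _ /=.
by rewrite -scalerAr -scalerAl scalerDr.
Qed.

Lemma Dm_sum (I : finType) (c : I -> S) (x : I -> 'M[S]_K.+1) :
  Dm (\sum_i c i *: x i) = \sum_i c i *: Dm (x i).
Proof.
rewrite /Dm mulr_sumr mulr_suml -sumrB; apply: eq_bigr => i _ /=.
by rewrite -scalerAr -scalerAl scalerBr.
Qed.

Let y i := \sum_s ((l i j0)@_U_(s))%:MP *: e s.
Let Y := \sum_i q 0 i *: y i.

(** Writing the column l_{. j0} as \sum_s z_s L_s with constant L_s, the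
    elements [y i] = \sum_s L_is e_s form a primitive of that column. *)
Lemma Dp_y i : Dp (y i) = (l i j0)%:A.
Proof.
rewrite /y Dp_sum; under eq_bigr => s _ do rewrite /Dp de scalerA mul_mpolyC.
by rewrite -scaler_suml -homog1E.
Qed.

Lemma y_anti i j : y i * y j = - (y j * y i).
Proof.
rewrite /y !mulr_suml; under eq_bigr => s _ do rewrite mulr_sumr.
rewrite exchange_big -sumrN; apply: eq_bigr => t _ /=.
rewrite mulr_sumr -sumrN; apply: eq_bigr => s _.
by rewrite -!scalerAl -!scalerAr eC !scalerN !scalerA mulrC.
Qed.

Variable h : 'I_r -> 'I_r -> S.
Hypothesis hE : forall t, \sum_s 'X_s * (h s t - h t s) =
  \sum_i q 0 i * ((l i j0)@_U_(t))%:MP.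

Let u := \sum_p h p.1 p.2 *: (e p.1 * e p.2).

(** Modulo q, u is a cycle: its differential is the combination [Y] of the
    q_i. It is the class in Tor_2 of the column j0. *)
Lemma Dm_u : Dm u = Y.
Proof.
have Dee s t : Dm (e s * e t) = 'X_s *: e t - 'X_t *: e s.
  have -> : Dm (e s * e t) = Dp (e s) * e t - e s * Dp (e t).
    by rewrite /Dm /Dp mulrDl mulrDr !mulrA opprD addrA addrK.
  by rewrite /Dp !de -scalerAl mul1r -scalerAr mulr1.
rewrite /u Dm_sum -(pair_bigA _ (fun s t => h s t *: Dm (e s * e t))) /=.
under eq_bigr => s _ do under eq_bigr => t _ do rewrite Dee scalerBr !scalerA.
under eq_bigr => s _ do rewrite sumrB.
rewrite sumrB exchange_big -sumrB /Y /=.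
under [RHS]eq_bigr => i _ do rewrite /y scaler_sumr.
rewrite [RHS]exchange_big; apply: eq_bigr => t _ /=.
under [RHS]eq_bigr => i _ do rewrite scalerA.
rewrite -!scaler_suml -hE -scalerBl -sumrB; congr (_ *: _).
by apply: eq_bigr => s _; rewrite mulrBr; congr (_ - _); rewrite mulrC.
Qed.

Lemma eeC s t w : GRing.comm (e s * e t) (e w).
Proof.
rewrite /GRing.comm -mulrA [e t * e w]eC mulrN [e s * (e w * _)]mulrA [e s * e w]eC.
by rewrite mulNr opprK -mulrA.
Qed.

Lemma u_comm_e w : GRing.comm u (e w).
Proof.
apply/commr_sym/commr_sum => -[s t] _; apply/commr_sym.
by rewrite /GRing.comm -scalerAl -scalerAr eeC.
Qed.

Lemma u_comm_y i : GRing.comm u (y i).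
Proof.
apply/commr_sum => s _; rewrite /GRing.comm -scalerAl -scalerAr.
by rewrite u_comm_e.
Qed.

Lemma u_comm_Y : GRing.comm u Y.
Proof.
apply/commr_sum => i _; rewrite /GRing.comm -scalerAl -scalerAr.
by rewrite u_comm_y.
Qed.

Lemma u_nilpotent : exists N, u ^+ N = 0.
Proof.
apply: nilpotent_sum => [[s t]|[s t] [s' t']] /=.
  rewrite -scalerAl -scalerAr -[e s * e t * _]mulrA [e t * (e s * _)]mulrA.
  by rewrite [e t * e s]eC mulNr -mulrA ee mulr0 oppr0 mulr0 !scaler0.
by apply/comm_scale/commrM; apply: eeC.
Qed.

Lemma Dm_uX N : Dm (u ^+ N) = (u ^+ N.-1 * Y) *+ N.
Proof.
elim: N => [|N IH]; first by rewrite mulr0n expr0 /Dm mulr1 mul1r subrr.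
rewrite exprS DmM Dm_u IH.
have -> : Y * u ^+ N = u ^+ N * Y by apply/commrX/commr_sym/u_comm_Y.
rewrite mulrnAr mulrA -exprS /= mulrS; case: N {IH} => [|N] /=.
  by rewrite !mulr0n.
by [].
Qed.

Let boundary x := exists (xi : 'M[S]_K.+1) (g : 'I_m -> 'M[S]_K.+1),
  x = Dp xi + \sum_i q 0 i *: g i.

Hypothesis vj0 : v 0 j0 != 0.

(** One application of the derivation theta to u^(N+1) = 0 in homology,
    written without homology. Differentiating u^(N+1) = Dp xi + q g shows that
    (N+1) u^N y - Dm g is a syzygy of q, hence of the form l A. Differentiating
    once more compares l (Dp A) with (N+1) u^N l_{. j0} up to a Koszul
    syzygy, and applying v gives (N+1) v_j0 u^N = Dp (v A) modulo q. *)
Lemma boundary_descent N : boundary (u ^+ N.+1) -> boundary (u ^+ N).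
Proof.
move=> [xi [g uE]].
have half : 2%:R^-1 + 2%:R^-1 = 1 :> k.
  by rewrite -mulr2n -[LHS]mulr_natr mulVf // natr_neq0.
pose zeta i := (u ^+ N * y i) *+ N.+1 - Dm (g i).
have z0 : \sum_i q 0 i *: zeta i = 0.
  have := congr1 Dm uE; rewrite Dm_uX /= /Dm mulrDr mulrDl opprD addrACA -/(Dm _).
  rewrite -/(Dm (\sum_i _)) DmDp add0r Dm_sum => e1.
  under eq_bigr => i _ do rewrite scalerBr.
  rewrite sumrB -e1 /Y mulr_sumr -sumrMnl; apply/eqP; rewrite subr_eq0; apply/eqP.
  by apply: eq_bigr => i _; rewrite -scalerAr scalerMnr.
have [A AE] : exists A : 'I_n -> 'M[S]_K.+1,
    forall i, zeta i = \sum_j l i j *: A j.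
  have : forall p : 'I_K.+1 * 'I_K.+1, exists a : 'cV[S]_n,
      \col_i zeta i p.1 p.2 = l *m a.
    move=> [a b]; apply/lsyz/matrixP => i j; rewrite !ord1 !mxE /=.
    move/matrixP/(_ a b): z0; rewrite summxE mxE => z0; rewrite -[RHS]z0.
    by apply: eq_bigr => i' _; rewrite !mxE.
  move/fin_all_exists=> [al alE].
  exists (fun j => \matrix_(a, b) al (a, b) j 0) => i.
  apply/matrixP => a b; move/matrixP/(_ i 0): (alE (a, b)).
  rewrite !mxE /= => ->; rewrite summxE; apply: eq_bigr => j _.
  by rewrite !mxE.
(* the defect is a Koszul syzygy because the odd elements y_i anticommute *)
pose c i j := (u ^+ N.-1 * (y j * y i)) *+ N *+ N.+1.
have cN i j : c i j = - c j i by rewrite /c y_anti mulrN !mulNrn.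
have DA i : \sum_j l i j *: Dp (A j) =
    \sum_j q 0 j *: c i j + l i j0 *: (u ^+ N *+ N.+1).
  rewrite -Dp_sum -AE /zeta.
  have -> : Dp (u ^+ N * y i *+ N.+1 - Dm (g i)) = Dp (u ^+ N * y i) *+ N.+1.
    rewrite -[RHS]subr0 -(DpDm (g i)) /Dp mulrBr mulrBl mulrnAr mulrnAl addrACA.
    by rewrite -mulrnDl -opprD.
  rewrite DpM Dp_y -scalerAr mulr1 mulrnDl -scalerMnr; congr (_ + _).
  rewrite Dm_uX /Y mulrnAl -mulrA mulr_suml mulr_sumr -!sumrMnl.
  by apply: eq_bigr => j _; rewrite /c -scalerAl -scalerAr !scalerMnr.
pose B j := Dp (A j) - (j == j0)%:R *: (u ^+ N *+ N.+1).
have BE i : \sum_j l i j *: B j = \sum_j q 0 j *: c i j.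
  under eq_bigr => j _ do rewrite /B scalerBr.
  rewrite sumrB DA [X in _ - X](bigD1 j0) //= eqxx scale1r [X in _ - (_ + X)]big1 ?addr0 ?addrK //.
  by move=> j /negPf ->; rewrite scale0r scaler0.
have [X XE] : exists X : 'I_m -> 'M[S]_K.+1,
    \sum_j (v 0 j)%:MP *: B j = \sum_i q 0 i *: X i.
  have : forall p : 'I_K.+1 * 'I_K.+1, exists x : 'cV[S]_m,
      map_mx (@mpolyC r k) v *m \col_j B j p.1 p.2 = q *m x.
    move=> [a b]; apply: (vK (c := \matrix_(i, j) (2%:R^-1 *: c i j a b))).
    apply/matrixP => i j; rewrite !ord1 !mxE /=.
    have := congr1 (fun M : 'M_ _ => M a b) (BE i).
    rewrite !summxE => eD.
    transitivity ((\sum_j (l i j *: B j) a b)).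
      by apply: eq_bigr => j' _; rewrite !mxE.
    rewrite eD; apply: eq_bigr => j' _; rewrite !mxE mulrC; congr (_ * _).
    rewrite [c j' i]cN mxE scalerN opprK -scalerDl half.
    by rewrite scale1r.
  move/fin_all_exists=> [x xE].
  exists (fun j => \matrix_(a, b) x (a, b) j 0).
  apply/matrixP => a b; move/matrixP/(_ 0 0): (xE (a, b)).
  rewrite !mxE !summxE /= => eD; under [RHS]eq_bigr => j _ do rewrite !mxE.
  by rewrite -eD; apply: eq_bigr => j _; rewrite !mxE.
pose w := (N.+1%:R * v 0 j0)^-1.
have wE : w%:MP *: ((v 0 j0)%:MP *: (u ^+ N *+ N.+1)) = u ^+ N.
  rewrite !scalerA -scaler_nat scalerA -mpolyC_nat -!mpolyCM mulrAC.
  by rewrite /w -mulrA mulVf ?mpolyC1 ?scale1r // mulf_neq0 // natr_neq0.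
exists (\sum_j (w * v 0 j)%:MP *: A j), (fun i => - (w%:MP *: X i)).
rewrite Dp_sum; under [X in _ + X]eq_bigr => i _ do
  rewrite scalerN scalerA mulrC -scalerA.
under [X in X + _]eq_bigr => i _ do rewrite mpolyCM -scalerA.
rewrite sumrN -!scaler_sumr -XE -scalerBr -sumrB.
rewrite (bigD1 j0) //= big1 => [|j jj0].
  by rewrite -scalerBr /B eqxx scale1r opprB addrCA subrr !addr0 wE.
by rewrite -scalerBr /B (negPf jj0) scale0r subr0 subrr scaler0.
Qed.

End Descent.

(** Descending from a vanishing power of u to u^0 = 1 would make 1 a
    boundary modulo q, although d and q have no constant term. *)
Theorem obstruction_functional_eq0 : v = 0.
Proof.
apply/rowP => j0; rewrite mxE; apply/eqP/negPn/negP => vj0.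
have [[|K] [e [d [K0 [dd de ee eC dI]]]]] :=
  koszul_operators (fun s : 'I_r => 'X_s : S); first by [].
have [h hE] : exists h : 'I_r -> 'I_r -> S,
    forall t, \sum_s 'X_s * (h s t - h t s) =
      \sum_i q 0 i * ((l i j0)@_U_(t))%:MP.
  apply: koszul_primitive => // [s|].
    apply: rpred_sum => i _; rewrite mulrC mul_mpolyC; exact/rpredZ/q2.
  under eq_bigr => s _ do rewrite mulr_sumr.
  rewrite exchange_big /=; transitivity ((q *m l) 0 j0); last first.
    by rewrite mul_syzygies mxE.
  rewrite mxE; apply: eq_bigr => i _.
  rewrite [in RHS](homog1E (l1 i j0)) mulr_sumr; apply: eq_bigr => s _.
  by rewrite -mul_mpolyC mulrCA; congr (_ * _); exact: mulrC.
have de' s : d * e s + e s * d = ('X_s : S)%:A by have := de s; rewrite -scalemx1.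
have [N uN] := u_nilpotent ee eC h.
pose u := \sum_p h p.1 p.2 *: (e p.1 * e p.2).
have descent M : (exists (xi : 'M[S]_K.+1) (g : 'I_m -> 'M[S]_K.+1),
      u ^+ M = (d * xi + xi * d) + \sum_i q 0 i *: g i) ->
    exists (xi : 'M[S]_K.+1) (g : 'I_m -> 'M[S]_K.+1),
      u ^+ 0 = (d * xi + xi * d) + \sum_i q 0 i *: g i.
  elim: M => [//|M IH] bM; apply/IH.
  exact: (boundary_descent dd de' eC hE vj0 bM).
have [|xi [g]] := descent N.
  exists 0, (fun=> 0); rewrite uN mulr0 mul0r big1 ?addr0 // => i _.
  by rewrite scaler0.
move=> /matrixP/(_ 0 0)/(congr1 (mcoeff 0%MM)).
pose I (p : S) := p@_0%MM = 0.
have II : is_ideal I.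
  split=> [|x y|a x]; rewrite /I ?mcoeff0 //.
    by move=> x0 y0; rewrite mcoeffD x0 y0 addr0.
  by move=> x0; rewrite rmorphM /= x0 mulr0.
have dI' i j : I (d i j).
  by apply: dI => // s; rewrite /I mcoeffX mnm1_eq0.
rewrite expr0 !mxE eqxx mcoeff1 eqxx summxE !mcoeffD !raddf_sum /=.
rewrite !big1 ?addr0; first by move/eqP; rewrite oner_eq0.
- move=> i _; rewrite mxE rmorphM /= (dhomog_nemf_coeff (q2 i)) ?mul0r //.
  by rewrite mf0.
- by move=> i _; rewrite rmorphM /= [X in _ * X]dI' mulr0.
- by move=> i _; rewrite rmorphM /= [X in X * _]dI' mul0r.
Qed.

End Rigidity.

(** * Normal forms and base change of syzygies *)

Lemma mpoly_rmorphism_ext (K : comNzRingType) (N : nat) (T : comNzRingType)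
    (f g : {rmorphism {mpoly K[N]} -> T}) :
  (forall a, f a%:MP = g a%:MP) -> (forall v, f 'X_v = g 'X_v) -> f =1 g.
Proof.
move=> fC fg; elim/mpolyind => [|c mon p _ _ IH]; first by rewrite !rmorph0.
rewrite !rmorphD /= IH -mul_mpolyC !rmorphM /= fC; congr (_ * _ + _).
rewrite mpolyXE_id !rmorph_prod /=; apply: eq_bigr => v _.
by rewrite !rmorphXn /= fg.
Qed.

Lemma lrmorphism_ext (k : fieldType) (N M : nat)
    (f g : {lrmorphism {mpoly k[N]} -> {mpoly k[M]}}) :
  (forall v, f 'X_v = g 'X_v) -> f =1 g.
Proof.
move=> fg; apply: (mpoly_rmorphism_ext (f := f) (g := g)) => // c.
have hC (h : {lrmorphism {mpoly k[N]} -> {mpoly k[M]}}) : h c%:MP = c%:MP.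
  by rewrite -alg_mpolyC linearZ /= rmorph1 -mul_mpolyC mulr1.
exact: etrans (hC f) (esym (hC g)).
Qed.

Section NormalForm.
Variables (k : fieldType) (N : nat) (J : {mpoly k[N]} -> Prop).
Hypothesis J0 : J 0.
Hypothesis JD : forall x y, J x -> J y -> J (x + y).
Hypothesis JZ : forall (a : k) x, J x -> J (a *: x).

Let reduced (x : {mpoly k[N]}) := forall mon, x@_mon != 0 ->
  ~ exists g, [/\ J g, g != 0 & mlead g = mon].

Lemma reduced_lin a x y : reduced x -> reduced y -> reduced (a *: x + y).
Proof.
move=> rx ry mon; rewrite mcoeffD mcoeffZ.
have [x0|/rx //] := eqVneq x@_mon 0.
by rewrite x0 mulr0 add0r; apply: ry.
Qed.

Lemma reduced_eq0 x : reduced x -> J x -> x = 0.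
Proof.
move=> rx Jx; apply/eqP/negPn/negP => x0.
by apply: (rx (mlead x)); [rewrite mleadc_eq0 | exists x].
Qed.

(** Division with remainder by the leading monomials of the elements of J;
    it terminates because monomials are well ordered. *)
Lemma reduced_exists p : exists x, reduced x /\ J (p - x).
Proof.
elim/mleadrect: p => p IH.
have [->|p0] := eqVneq p 0.
  by exists 0; rewrite subrr; split=> // mon; rewrite mcoeff0 eqxx.
have IH' g : mlead g = mlead p -> g@_(mlead p) = p@_(mlead p) ->
    exists x, reduced x /\ J (p - g - x).
  move=> lg cg; have [->|pg0] := eqVneq (p - g) 0.
    by exists 0; rewrite subrr; split=> // mon; rewrite mcoeff0 eqxx.
  apply: IH; rewrite lt_neqAle; apply/andP; split.
    apply/eqP=> e; move: pg0; rewrite -mleadc_eq0 e mcoeffB cg subrr.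
    by rewrite eqxx.
  by apply: (le_trans (mleadB_le _ _)); rewrite lg joinxx.
have [[g [Jg g0 lg]]|no] := classic (exists g, [/\ J g, g != 0 & mlead g = mlead p]).
  pose c := p@_(mlead p) / g@_(mlead p).
  have gc0 : g@_(mlead p) != 0 by rewrite -lg mleadc_eq0.
  have c0 : c != 0 by rewrite mulf_neq0 ?invr_eq0 // mleadc_eq0.
  have [||x [rx Jx]] := IH' (c *: g); first by rewrite mleadZ.
    by rewrite mcoeffZ mulfVK.
  exists x; split=> //; have := JD Jx (JZ c Jg).
  by rewrite addrAC subrK.
have [||x [rx Jx]] := IH' (p@_(mlead p) *: 'X_[mlead p]).
- by rewrite mleadZ ?mleadXm // mleadc_eq0.
- by rewrite mcoeffZ mcoeffX eqxx mulr1.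
exists (p@_(mlead p) *: 'X_[mlead p] + x); split; last by rewrite opprD addrA.
apply: reduced_lin => // mon; rewrite mcoeffX; have [<- _ //|_] := (mlead p =P mon).
by rewrite eqxx.
Qed.

(** A linear projection with kernel J, that is, a complement of J. It
    replaces the quotient by J, which need not be decidable. *)
Lemma normal_form : exists pi : {linear {mpoly k[N]} -> {mpoly k[N]}},
  (forall p, J (p - pi p)) /\ (forall p, J p -> pi p = 0).
Proof.
pose pi p := proj1_sig (constructive_indefinite_description _ (reduced_exists p)).
have piP p : reduced (pi p) /\ J (p - pi p).
  by rewrite /pi; case: constructive_indefinite_description.
have piE p x : reduced x -> J (p - x) -> pi p = x.
  move=> rx Jx; have [rp Jp] := piP p; apply/eqP; rewrite -subr_eq0; apply/eqP.
  apply: reduced_eq0.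
    by rewrite addrC -scaleN1r; apply: reduced_lin.
  have := JD Jx (JZ (-1) Jp).
  by rewrite scaleN1r opprB addrC addrA subrK.
have lin : linear pi.
  move=> a x y; have [rx Jx] := piP x; have [ry Jy] := piP y.
  apply: piE; first exact: reduced_lin.
  have := JD (JZ a Jx) Jy.
  by rewrite scalerBr addrACA opprD.
pose mix := GRing.isLinear.Build k {mpoly k[N]} {mpoly k[N]} *:%R pi lin.
pose piL : {linear {mpoly k[N]} -> {mpoly k[N]}} := HB.pack pi mix.
exists piL; split=> p; first by have [] := piP p.
move=> Jp; apply: piE; last by rewrite subr0.
by move=> mon; rewrite mcoeff0 eqxx.
Qed.

End NormalForm.

Definition coefs_in (N r : nat) (k : fieldType) (J : {mpoly k[N]} -> Prop)
  (x : {mpoly {mpoly k[N]}[r]}) := forall mon, J x@_mon.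

Local Notation lift_z N := (map_mpoly (@mpolyC N _)).

(** A k-linear functional on the coefficients induces an S-linear map from
    k[c,d,n][z] to S = k[z]. *)
Lemma map_mpoly_lift (N r : nat) (k : fieldType) (phi : {scalar {mpoly k[N]}})
   (f : {mpoly k[r]}) (x : {mpoly {mpoly k[N]}[r]}) :
  map_mpoly phi (lift_z N f * x) = f * map_mpoly phi x.
Proof.
apply/mpolyP => mon; rewrite mcoeff_map_mpoly.
rewrite !(mcoeff_poly_mul _ _ (ltnSn _)) raddf_sum; apply: eq_bigr => mm _ /=.
by rewrite !mcoeff_map_mpoly mul_mpolyC linearZ.
Qed.

Lemma map_mpoly_lift_mul (N r m n : nat) (k : fieldType)
   (phi : {scalar {mpoly k[N]}})
   (A : 'M[{mpoly k[r]}]_(m, n)) (u : 'cV[{mpoly {mpoly k[N]}[r]}]_n) :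
  map_mx (map_mpoly phi) (map_mx (lift_z N) A *m u) = A *m map_mx (map_mpoly phi) u.
Proof.
apply/matrixP => i j; rewrite !mxE raddf_sum; apply: eq_bigr => t _ /=.
by rewrite !mxE map_mpoly_lift.
Qed.

Lemma mpoly_slices (N r : nat) (k : fieldType) (w : nat) (x : {mpoly {mpoly k[N]}[r]}) :
  (forall mon, msize x@_mon <= w)%N ->
  x = \sum_(mu : 'X_{1..N < w}) lift_z N (map_mpoly (mcoeff mu) x) * ('X_[mu])%:MP.
Proof.
move=> xw; apply/mpolyP => mon; rewrite {1}(mpolywE (xw mon)) raddf_sum.
apply: eq_bigr => mu _ /=; rewrite mulrC mcoeffCM !mcoeff_map_mpoly.
by rewrite mulrC mul_mpolyC.
Qed.

Lemma coef_size_bound (N r m : nat) (k : fieldType) (u : 'I_m -> {mpoly {mpoly k[N]}[r]}) :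
  exists w, forall i mon, (msize (u i)@_mon <= w)%N.
Proof.
exists (\max_i \max_(mon <- msupp (u i)) msize (u i)@_mon) => i mon.
have [h|/memN_msupp_eq0 ->] := boolP (mon \in msupp (u i)); last by rewrite mmeasure0.
by apply: leq_trans (leq_bigmax i); rewrite (big_rem mon) //= leq_maxl.
Qed.

(** Base change from k to k[c,d,n]/J is flat, so l still generates the
    syzygies of q. Concretely, the S-linear slices of the normal form of u along
    the monomials of k[c,d,n] are syzygies over S. *)
Lemma flat_syzygies (k : fieldType) (N r m n : nat) (J : {mpoly k[N]} -> Prop)
    (q : 'rV[{mpoly k[r]}]_m) (l : 'M[{mpoly k[r]}]_(m, n)) :
  is_ideal J -> generates_syzygies q l ->
  forall u : 'cV[{mpoly {mpoly k[N]}[r]}]_m,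
  (forall i j, coefs_in J ((map_mx (lift_z N) q *m u) i j)) ->
  exists a : 'cV_n, forall i j, coefs_in J ((u - map_mx (lift_z N) l *m a) i j).
Proof.
move=> [J0 JD JM] lsyz u Ju.
have [|pi [piJ pi0]] := normal_form J0 JD.
  by move=> a x Jx; rewrite -mul_mpolyC; apply: JM.
pose U := map_mx (map_mpoly pi) u.
have [w Uw] := coef_size_bound (fun i => U i 0).
have : forall mu : 'X_{1..N < w}, exists a : 'cV[{mpoly k[r]}]_n,
    map_mx (map_mpoly (mcoeff mu)) U = l *m a.
  move=> mu; apply/lsyz.
  pose phi : {scalar {mpoly k[N]}} := mcoeff mu \o pi.
  have -> : map_mx (map_mpoly (mcoeff mu)) U = map_mx (map_mpoly phi) u.
    apply/matrixP => i j; rewrite !mxE; apply/mpolyP => mon.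
    by rewrite !mcoeff_map_mpoly.
  rewrite -map_mpoly_lift_mul; apply/matrixP => i j; rewrite [LHS]mxE [RHS]mxE.
  apply/mpolyP => mon; rewrite mcoeff_map_mpoly mcoeff0 /= pi0 ?mcoeff0 //.
  exact: Ju.
move/fin_all_exists => [al alE].
exists (\sum_(mu : 'X_{1..N < w}) ('X_[mu])%:MP *: map_mx (lift_z N) (al mu)).
suff -> : map_mx (lift_z N) l *m
    (\sum_(mu : 'X_{1..N < w}) ('X_[mu])%:MP *: map_mx (lift_z N) (al mu)) = U.
  by move=> i j mon; rewrite !mxE mcoeffB mcoeff_map_mpoly; apply: piJ.
rewrite mulmx_sumr; apply/matrixP => i j; rewrite !ord1.
rewrite [RHS](mpoly_slices (Uw i)) summxE; apply: eq_bigr => mu _.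
rewrite -scalemxAr mxE mulrC; congr (_ * _).
move/matrixP/(_ i 0): (alE mu); rewrite [LHS]mxE => ->; rewrite !mxE raddf_sum.
by apply: eq_bigr => t _; rewrite /= !mxE rmorphM.
Qed.

(** * Lifting Koszul syzygies *)

Definition entries_in (R : comNzRingType) (J : R -> Prop) (m n : nat)
  (A : 'M[R]_(m, n)) : Prop := forall i j, J (A i j).

Lemma addmxE (R : comNzRingType) m n (A B : 'M[R]_(m, n)) i j :
  (A + B) i j = A i j + B i j.
Proof. by rewrite mxE. Qed.

Lemma oppmxE (R : comNzRingType) m n (A : 'M[R]_(m, n)) i j :
  (- A) i j = - A i j.
Proof. by rewrite mxE. Qed.

Section EntriesIn.
Variables (R : comNzRingType) (J : R -> Prop).
Hypothesis JI : is_ideal J.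

Lemma ideal_opp x : J x -> J (- x).
Proof. by case: JI => _ _ JM Jx; rewrite -mulN1r; apply: JM. Qed.

Lemma ideal_sum (I : Type) (s : seq I) (P : pred I) (F : I -> R) :
  (forall i, P i -> J (F i)) -> J (\sum_(i <- s | P i) F i).
Proof. by case: JI => J0 JD _ JF; apply: big_ind. Qed.

Lemma entries_inD m n (A B : 'M[R]_(m, n)) :
  entries_in J A -> entries_in J B -> entries_in J (A + B).
Proof. by case: JI => _ JD _ JA JB i j; rewrite mxE; apply: JD. Qed.

Lemma entries_inN m n (A : 'M[R]_(m, n)) :
  entries_in J A -> entries_in J (- A).
Proof. by move=> JA i j; rewrite mxE; apply: ideal_opp. Qed.

Lemma entries_inMl m n p (A : 'M[R]_(m, n)) (B : 'M[R]_(n, p)) :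
  entries_in J B -> entries_in J (A *m B).
Proof. by case: JI => _ _ JM JB i j; rewrite mxE; apply: ideal_sum => t _; apply: JM. Qed.

Lemma entries_inMr m n p (A : 'M[R]_(m, n)) (B : 'M[R]_(n, p)) :
  entries_in J A -> entries_in J (A *m B).
Proof.
case: JI => _ _ JM JA i j; rewrite mxE; apply: ideal_sum => t _.
by rewrite mulrC; apply: JM.
Qed.

End EntriesIn.

Section KoszulLift.
Variables (R : comNzRingType) (J : R -> Prop) (m n : nat).
Variables (Q E D : 'rV[R]_m) (L N : 'M[R]_(m, n)).
Hypothesis JI : is_ideal J.
Hypothesis H1 : entries_in J (Q *m N - E *m L).
Hypothesis H2 : entries_in J (E *m N + D *m L).
Hypothesis flat : forall u : 'cV[R]_m, entries_in J (Q *m u) ->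
  exists a : 'cV[R]_n, entries_in J (u - L *m a).

Lemma alternating_swap (c : 'M[R]_m) (X Y : 'rV[R]_m) :
  X *m (c - c^T) *m Y^T = - (Y *m (c - c^T) *m X^T).
Proof.
have tr1 (M : 'M[R]_1) : M^T = M by apply/matrixP => i j; rewrite mxE !ord1.
have bT : (c - c^T)^T = - (c - c^T) by rewrite linearB /= trmxK opprB.
by rewrite -[LHS]tr1 !trmx_mul trmxK bT mulmxA mulmxN mulNmx.
Qed.

Lemma alternating_square (c : 'M[R]_m) (X : 'rV[R]_m) :
  X *m (c - c^T) *m X^T = 0.
Proof.
have tr1 (M : 'M[R]_1) : M^T = M by apply/matrixP => i j; rewrite mxE !ord1.
rewrite mulmxBr mulmxBl -[X *m c *m X^T]tr1 !trmx_mul trmxK mulmxA subrr //.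
Qed.

(** Let F = Q - E z_0 - D z_0^2 and b = c - c^T. The equality
    L a0 = b Q^T extends to (L + N z_0)(a0 - a1 z_0 - a2 z_0^2) = b F^T up to
    z_0^2: the obstructions N a0 + b E^T and b D^T - N a1 are syzygies of Q
    modulo J by the two hypotheses on relations, so they equal L a1 and L a2.
    As F b F^T = 0, the coefficient of z_0^3 then compares D N a0 with
    Q N a2. *)
Lemma koszul_lift (c : 'M[R]_m) (a0 : 'cV[R]_n) :
  L *m a0 = (c - c^T) *m Q^T ->
  exists x : 'cV[R]_m, entries_in J (Q *m x - D *m N *m a0).
Proof.
move=> a0E; set b := c - c^T in a0E.
have La0 X : X *m L *m a0 = - (Q *m b *m X^T).
  by rewrite -mulmxA a0E mulmxA alternating_swap.
have swap := alternating_swap c; have square := alternating_square c.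
rewrite -/b in swap square; clearbody b.
have [|a1 Ja1] := flat (u := N *m a0 + b *m E^T).
  have -> : Q *m (N *m a0 + b *m E^T) = (Q *m N - E *m L) *m a0.
    by rewrite mulmxDr mulmxBl !mulmxA La0 opprK.
  exact: entries_inMr.
set u1 := N *m a0 + _ in Ja1.
have Eu1 : E *m u1 = (E *m N + D *m L) *m a0 + Q *m b *m D^T.
  rewrite /u1 mulmxDr mulmxDl !mulmxA La0 square.
  by rewrite addr0 subrK.
have [|a2 Ja2] := flat (u := b *m D^T - N *m a1).
  have -> : Q *m (b *m D^T - N *m a1) = E *m (u1 - L *m a1)
      - (Q *m N - E *m L) *m a1 - (E *m N + D *m L) *m a0.
    rewrite !mulmxBr mulmxBl Eu1 !mulmxA; apply/matrixP => i j; rewrite !ord1.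
    by rewrite !(addmxE, oppmxE); ring.
  apply: (entries_inD JI); last by apply/(entries_inN JI)/(entries_inMr JI).
  apply: (entries_inD JI); last by apply/(entries_inN JI)/(entries_inMr JI).
  exact: entries_inMl.
set u2 := _ - N *m a1 in Ja2.
have Eu2 : E *m u2 = E *m b *m D^T - (E *m N + D *m L) *m a1 + D *m L *m a1.
  rewrite /u2 mulmxBr mulmxDl !mulmxA opprD addrA subrK.
  by [].
exists (N *m a2).
have -> : Q *m (N *m a2) - D *m N *m a0 = (Q *m N - E *m L) *m a2
    - E *m (u2 - L *m a2) - (E *m N + D *m L) *m a1 - D *m (u1 - L *m a1).
  rewrite [E *m (_ - _)]mulmxBr Eu2 [D *m (_ - _)]mulmxBr [D *m u1]mulmxDr.
  rewrite [D *m (b *m _)]mulmxA (swap D E).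
  rewrite !mulmxBl !mulmxDl !mulmxA; apply/matrixP => i j; rewrite !ord1.
  by rewrite !(addmxE, oppmxE); ring.
apply: (entries_inD JI); last by apply/(entries_inN JI)/(entries_inMl JI).
apply: (entries_inD JI); last by apply/(entries_inN JI)/(entries_inMr JI).
apply: (entries_inD JI); last by apply/(entries_inN JI)/(entries_inMl JI).
exact: entries_inMr.
Qed.

End KoszulLift.

(** * The cubic relations are redundant *)

Lemma coefs_in_ideal (k : fieldType) (N r : nat) (J : {mpoly k[N]} -> Prop) :
  is_ideal J -> is_ideal (@coefs_in N r k J).
Proof.
move=> JI; have [J0 JD JM] := JI; split=> [mon|x y Jx Jy mon|a x Jx mon].
- by rewrite mcoeff0.
- by rewrite mcoeffD; apply: JD.
- by rewrite (mcoeff_poly_mul _ _ (ltnSn _)); apply: ideal_sum => // mm _; apply/JM/Jx.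
Qed.

(** If D0 N0 had an entry outside J, a coefficient of its normal form would
    be a functional v of the kind excluded by [obstruction_functional_eq0]. *)
Theorem cubic_relations_redundant (k : fieldType) (N r m n : nat)
    (q : 'rV[{mpoly k[r]}]_m) (l : 'M[{mpoly k[r]}]_(m, n))
    (J : {mpoly k[N]} -> Prop) (E : 'rV[{mpoly {mpoly k[N]}[r]}]_m)
    (D0 : 'rV[{mpoly k[N]}]_m) (N0 : 'M[{mpoly k[N]}]_(m, n)) :
  [pchar k] =i pred0 -> (forall i, q 0 i \is 2.-homog) ->
  (forall i j, l i j \is 1.-homog) -> generates_syzygies q l ->
  is_ideal J ->
  entries_in (coefs_in J) (map_mx (lift_z N) q *m map_mx (@mpolyC r _) N0
    - E *m map_mx (lift_z N) l) ->
  entries_in (coefs_in J) (E *m map_mx (@mpolyC r _) N0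
    + map_mx (@mpolyC r _) D0 *m map_mx (lift_z N) l) ->
  entries_in J (D0 *m N0).
Proof.
move=> char0 q2 l1 lsyz JI H1 H2 i j; rewrite [i]ord1 {i}.
have [J0 JD JM] := JI.
have [|pi [piJ pi0]] := normal_form J0 JD.
  by move=> a x Jx; rewrite -mul_mpolyC; apply: JM.
apply: NNPP => wJ.
have [mu mu0] : exists mu, (pi ((D0 *m N0) 0 j))@_mu != 0.
  apply: NNPP => no; apply: wJ; rewrite -[X in J X]subr0.
  suff <- : pi ((D0 *m N0) 0 j) = 0 by apply: piJ.
  apply/mpolyP => mu; rewrite mcoeff0; apply/eqP/negPn/negP => h.
  by apply: no; exists mu.
pose phi : {scalar {mpoly k[N]}} := mcoeff mu \o pi.
have phiJ p : J p -> phi p = 0 by move=> Jp; rewrite /= pi0 // mcoeff0.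
pose v := map_mx phi (D0 *m N0).
suff v0 : v = 0 by move: mu0; have /rowP/(_ j) := v0; rewrite !mxE /= => ->; rewrite eqxx.
apply: (obstruction_functional_eq0 char0 q2 l1 lsyz) => a c la.
have [||x Jx] := koszul_lift (coefs_in_ideal r JI) H1 H2 _
    (c := map_mx (lift_z N) c) (a0 := map_mx (lift_z N) a).
- move=> u Ju; have [b Jb] := flat_syzygies JI lsyz Ju.
  by exists b.
- by rewrite -map_mxM la map_mxM map_mxB !map_trmx.
exists (map_mx (map_mpoly phi) x).
rewrite -map_mpoly_lift_mul; apply/matrixP => i s; rewrite !ord1.
have : map_mpoly phi ((map_mx (lift_z N) q *m x -
    map_mx (@mpolyC r _) D0 *m map_mx (@mpolyC r _) N0 *m map_mx (lift_z N) a) 0 0) = 0.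
  apply/mpolyP => mon; rewrite mcoeff_map_mpoly mcoeff0; apply: phiJ.
  exact: Jx.
rewrite addmxE oppmxE raddfB /= => /eqP; rewrite subr_eq0 => /eqP h.
rewrite [RHS]mxE h -map_mxM /=; rewrite !mxE raddf_sum; apply: eq_bigr => t _ /=.
rewrite [(map_mx _ a) _ _]mxE [(map_mx _ (D0 *m N0)) _ _]mxE [in RHS]mulrC.
rewrite -[mcoeff mu \o pi]/(phi : _ -> _) (map_mpoly_lift phi) mulrC.
by rewrite [LHS]mulrC map_mpolyC /v 2!mxE mulrC.
Qed.

(** * The coefficients of the deformed product *)

Section IdealGen.
Variable R : comNzRingType.
Implicit Types (G H I : R -> Prop).

Lemma ideal_gen_ideal G : is_ideal (ideal_gen G).
Proof. by split; [exact: ideal_gen0 | exact: ideal_genD | exact: ideal_genM]. Qed.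

Lemma mem_ideal_gen G x : G x -> ideal_gen G x.
Proof.
by move=> Gx; exists 1%N, (fun=> 1), (fun=> x); rewrite big_ord1 mul1r.
Qed.

Lemma ideal_gen_min G I : is_ideal I -> (forall x, G x -> I x) ->
  forall x, ideal_gen G x -> I x.
Proof.
move=> II GI x [n [a [g [Gg ->]]]]; apply: (ideal_sum II) => i _.
by case: II => _ _ IM; apply/IM/GI.
Qed.

Lemma ideal_gen_sub G H : (forall x, G x -> ideal_gen H x) ->
  forall x, ideal_gen G x -> ideal_gen H x.
Proof. by move=> GH; apply: ideal_gen_min => //; apply: ideal_gen_ideal. Qed.

End IdealGen.

Lemma ideal_gen_map (R S : comNzRingType) (f : {rmorphism R -> S})
  (G : R -> Prop) (H : S -> Prop) :
  (forall x, G x -> ideal_gen H (f x)) ->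
  forall x, ideal_gen G x -> ideal_gen H (f x).
Proof.
move=> GH x [n [a [g [Gg ->]]]]; rewrite rmorph_sum.
apply: (ideal_sum (ideal_gen_ideal H)) => i _; rewrite rmorphM.
exact/ideal_genM/GH.
Qed.

Lemma scalemxE (R : comNzRingType) m n (x : R) (A : 'M[R]_(m, n)) i j :
  (x *: A) i j = x * A i j.
Proof. by rewrite mxE. Qed.

Lemma deformed_expansion (R : comNzRingType) (m n : nat) (x : R)
    (A B C : 'rV[R]_m) (A' B' : 'M[R]_(m, n)) :
  (A - x *: B - x ^+ 2 *: C) *m (A' + x *: B') =
  A *m A' + x *: (A *m B' - B *m A') - x ^+ 2 *: (B *m B' + C *m A')
    - x ^+ 3 *: (C *m B').
Proof.
rewrite mulmxDr !mulmxBl -!scalemxAl -!scalemxAr.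
apply/matrixP => i j; rewrite !(addmxE, oppmxE, scalemxE); ring.
Qed.

Lemma deformed_expansion_coef (R : comNzRingType) (m n : nat)
    (A B C : 'rV[R]_m) (A' B' : 'M[R]_(m, n)) (j : 'I_n) (e : nat) :
  (((map_mx (@polyC R) A - 'X *: map_mx (@polyC R) B
     - 'X ^+ 2 *: map_mx (@polyC R) C)
   *m (map_mx (@polyC R) A' + 'X *: map_mx (@polyC R) B')) 0 j)`_e =
  match e with
  | 0 => (A *m A') 0 j
  | 1 => (A *m B' - B *m A') 0 j
  | 2 => - (B *m B' + C *m A') 0 j
  | 3 => - (C *m B') 0 j
  | _ => 0
  end.
Proof.
rewrite deformed_expansion -!map_mxM !(addmxE, oppmxE, scalemxE).
have mE (M : 'rV[R]_n) : (map_mx (@polyC R) M) 0 j = (M 0 j)%:P by rewrite mxE.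
rewrite !mE -polyCN -!polyCD !coefD !coefN coefXM !coefXnM !coefC.
by case: e => [|[|[|[|e]]]] /=; rewrite ?(addr0, add0r, subr0, oppr0, sub0r).
Qed.

Section Relations.
Variables (k : fieldType) (r m n : nat).
Variables (q : 'rV[{mpoly k[r]}]_m) (l : 'M[{mpoly k[r]}]_(m, n)).

Local Notation nv := (nvars r m n).
Local Notation P := {mpoly k[nv]}.
Local Notation SP := {mpoly P[r]}.

Definition zC : 'rV[SP]_m :=
  (\row_j 'X_j) *m map_mx (@mpolyC r _) (Cmx k r m n).

Local Notation Q := (map_mx (lift_z nv) q).
Local Notation L := (map_mx (lift_z nv) l).
Local Notation Dh := (map_mx (@mpolyC r _) (Dmx k r m n)).
Local Notation Nh := (map_mx (@mpolyC r _) (Nmx k r m n)).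

Lemma deformed_product_coef e j : (deformed_product q l 0 j)`_e =
  match e with
  | 0 => (Q *m L) 0 j
  | 1 => (Q *m Nh - zC *m L) 0 j
  | 2 => - (zC *m Nh + Dh *m L) 0 j
  | 3 => - (Dh *m Nh) 0 j
  | _ => 0
  end.
Proof.
rewrite -deformed_expansion_coef.
have e1 a b (A : 'M[{mpoly k[r]}]_(a, b)) :
    map_mx (@of_z k r m n) A = map_mx (@polyC _) (map_mx (lift_z nv) A).
  by apply/matrixP => i s; rewrite !mxE.
have e2 a b (A : 'M[P]_(a, b)) :
    map_mx (@of_coef k r m n) A = map_mx (@polyC _) (map_mx (@mpolyC r _) A).
  by apply/matrixP => i s; rewrite !mxE.
have e3 : zrow k r m n = map_mx (@polyC _) (\row_j 'X_j).
  by apply/matrixP => i s; rewrite !mxE.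
by rewrite /deformed_product !e1 !e2 e3 -map_mxM -/zC.
Qed.

End Relations.

Lemma dhomog_comp (k : fieldType) (N M d : nat) (t : N.-tuple {mpoly k[M]})
    (p : {mpoly k[N]}) :
  (forall v, tnth t v \is 1.-homog) -> p \is d.-homog -> p \mPo t \is d.-homog.
Proof.
move=> ht hp; rewrite comp_mpolyEX big_seq; apply: rpred_sum => mon hmon.
have <- : mdeg mon = d := dhomog_mf hp hmon.
apply: rpredZ; rewrite comp_mpolyX mdegE.
elim/big_rec2: _ => [|v e x _ hx]; first exact: dhomog1.
by apply: dhomogM => //; rewrite -[X in X.-homog]mul1n; apply: dhomogMn.
Qed.

Section Forms.
Variables (k : fieldType) (r m n : nat).
Variables (q : 'rV[{mpoly k[r]}]_m) (l : 'M[{mpoly k[r]}]_(m, n)).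

Local Notation nv := (nvars r m n).
Local Notation P := {mpoly k[nv]}.
Local Notation SP := {mpoly P[r]}.
Local Notation Q := (map_mx (lift_z nv) q).
Local Notation L := (map_mx (lift_z nv) l).
Local Notation Dh := (map_mx (@mpolyC r _) (Dmx k r m n)).
Local Notation Nh := (map_mx (@mpolyC r _) (Nmx k r m n)).
Local Notation c_ i t := ('X_(mxvec_index i t) : {mpoly k[m * r]}).

Lemma embed_cX v : embed_c n ('X_v : {mpoly k[m * r]}) = cvar k n v.
Proof. by rewrite /embed_c comp_mpolyXU -tnth_nth tnth_mktuple. Qed.

Lemma zCE i : zC k r m n 0 i = \sum_t 'X_t * (embed_c n (c_ i t))%:MP.
Proof.
by rewrite mxE; apply: eq_bigr => t _; rewrite !mxE embed_cX.
Qed.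

Lemma lift_zE (f : {mpoly k[r]}) (a : P) (mon : 'X_{1..r}) :
  (lift_z nv f * a%:MP)@_mon = f@_mon *: a.
Proof. by rewrite mulrC mcoeffCM mcoeff_map_mpoly mulrC mul_mpolyC. Qed.

Lemma qN_coef j mon :
  ((Q *m Nh) 0 j)@_mon = \sum_i (q 0 i)@_mon *: Nmx k r m n i j.
Proof.
rewrite mxE raddf_sum; apply: eq_bigr => i _ /=.
by rewrite ![map_mx _ _ _ _]mxE lift_zE.
Qed.

Definition c_form j mon : {mpoly k[m * r]} :=
  \sum_i \sum_t ('X_t * l i j)@_mon *: c_ i t.

Lemma zCl_coef j mon : ((zC k r m n *m L) 0 j)@_mon = embed_c n (c_form j mon).
Proof.
rewrite mxE /embed_c !raddf_sum; apply: eq_bigr => i _ /=.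
rewrite zCE [map_mx _ _ _ _]mxE mulr_suml !raddf_sum; apply: eq_bigr => t _ /=.
rewrite comp_mpolyZ -/(embed_c n _) mulrAC -lift_zE rmorphM /= map_mpolyX.
by [].
Qed.

Lemma zCN_coef j mon : ((zC k r m n *m Nh) 0 j)@_mon =
  \sum_i \sum_t (U_(t)%MM == mon)%:R *: (embed_c n (c_ i t) * Nmx k r m n i j).
Proof.
rewrite mxE raddf_sum; apply: eq_bigr => i _ /=.
rewrite zCE [map_mx _ _ _ _]mxE mulr_suml raddf_sum; apply: eq_bigr => t _ /=.
rewrite -mulrA -rmorphM mulrC mcoeffCM mcoeffX mulr_natr.
by rewrite scaler_nat.
Qed.

Lemma Dl_coef j mon :
  ((Dh *m L) 0 j)@_mon = \sum_i (l i j)@_mon *: Dmx k r m n 0 i.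
Proof.
rewrite mxE raddf_sum; apply: eq_bigr => i _ /=.
by rewrite ![map_mx _ _ _ _]mxE mulrC lift_zE.
Qed.

End Forms.

(** * Elimination of the d's and n's *)

Section Eliminate.
Variables (k : fieldType) (r m n : nat).
Variables (q : 'rV[{mpoly k[r]}]_m) (l : 'M[{mpoly k[r]}]_(m, n)).
Hypothesis q2 : forall i, q 0 i \is 2.-homog.
Hypothesis l1 : forall i j, l i j \is 1.-homog.
Hypothesis qmin : minimal_generators q.
Hypothesis lsyz : generates_syzygies q l.
Hypothesis lmin : minimal_columns l.

Lemma minimal_no_relation (u : 'I_m -> k) :
  \sum_i u i *: q 0 i = 0 -> forall i, u i = 0.
Proof.
move=> uq i; apply/eqP/negPn/negP => ui0; apply: (qmin (i := i)).
have -> : q 0 i = \sum_(j | j != i) (- (u i)^-1 * u j) *: q 0 j.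
  move: uq; rewrite (bigD1 i) //= => /eqP; rewrite addr_eq0 => /eqP e.
  rewrite -[LHS]scale1r -(mulVf ui0) -scalerA e scalerN -scaleNr scaler_sumr.
  by apply: eq_bigr => j _; rewrite scalerA.
apply: (ideal_sum (ideal_gen_ideal _)) => j ji; rewrite -mul_mpolyC.
by apply/ideal_genM/mem_ideal_gen; exists j.
Qed.

Lemma row_independent_right_inverse (M : nat) (G : 'M[k]_(m, M)) :
  (forall u : 'rV_m, u *m G = 0 -> u = 0) ->
  exists X : 'M[k]_(M, m), G *m X = 1%:M.
Proof.
by move=> G0; exists (pinvmx G); apply: mulmxVp; apply: inj_row_free.
Qed.

(** Minimality makes the q_i linearly independent over k, so they have a dual
    family of functionals, given by combinations of coefficients. *)
Lemma quadric_dual : exists lam : 'I_m -> 'X_{1..r < 3} -> k,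
  forall i i', \sum_(mon : 'X_{1..r < 3}) (q 0 i)@_mon * lam i' mon = (i == i')%:R.
Proof.
pose T : finType := 'X_{1..r < 3}.
pose G : 'M[k]_(m, #|T|) := \matrix_(i < m, x < #|T|) (q 0 i)@_((@enum_val T T x : 'X_{1..r < 3}) : 'X_{1..r}).
have [|X GX] := @row_independent_right_inverse _ G.
  move=> u uG; apply/rowP => i; rewrite mxE; move: i.
  apply: minimal_no_relation; apply/mpolyP => mon; rewrite mcoeff0 raddf_sum /=.
  have [hm|hm] := ltnP (mdeg mon) 3.
    pose b := BMultinom hm.
    move/matrixP/(_ 0 (enum_rank b)): uG; rewrite !mxE => e; rewrite -[RHS]e.
    by apply: eq_bigr => i _; rewrite mcoeffZ !mxE enum_rankK.
  rewrite big1 // => i _; rewrite mcoeffZ (dhomog_nemf_coeff (q2 i)) ?mulr0 //.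
  by rewrite gtn_eqF.
exists (fun i' mon => X (enum_rank mon) i') => i i'.
move/matrixP/(_ i i'): GX; rewrite !mxE => <-.
rewrite (reindex (@enum_val T T)) /=; last first.
  by apply: onW_bij; apply: enum_val_bij.
by apply: eq_bigr => x _; rewrite mxE enum_valK.
Qed.

(** A constant row u with u l = 0 kills every syzygy, in particular the Koszul
    syzygies, whence u_i q_i' = u_i' q_i, against minimality. If there is a
    single quadric, its syzygies vanish and l can have no minimal column. *)
Lemma no_constant_row (j0 : 'I_n) (u : 'rV[k]_m) :
  (forall j, \sum_i u 0 i *: l i j = 0) -> u = 0.
Proof.
move=> ul; apply/rowP => i; rewrite mxE; apply/eqP/negPn/negP => ui0.
have [/existsP [i' ii']|no] := boolP [exists i', i' != i].
  (* the Koszul syzygy q_i' e_i - q_i e_i' *)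
  pose kz : 'cV[{mpoly k[r]}]_m :=
    \col_t (if t == i then q 0 i' else if t == i' then - q 0 i else 0).
  have kzE (v : 'I_m -> {mpoly k[r]}) : \sum_t v t * kz t 0 = v i * q 0 i' - v i' * q 0 i.
    rewrite (bigD1 i) //= (bigD1 i') //= big1 ?addr0.
      by rewrite !mxE eqxx (negPf ii') eqxx mulrN.
    by move=> t /andP [/negPf ti /negPf ti']; rewrite mxE ti ti' mulr0.
  have [a aE] : exists a, kz = l *m a.
    by apply/lsyz/matrixP => s t; rewrite !ord1 mxE kzE mxE mulrC subrr.
  have : \sum_t (u 0 t)%:MP * kz t 0 = 0.
    under eq_bigr => t _ do rewrite aE mxE mulr_sumr.
    rewrite exchange_big big1 // => j _ /=.
    under eq_bigr => t _ do rewrite mulrA mul_mpolyC.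
    by rewrite -mulr_suml ul mul0r.
  rewrite kzE !mul_mpolyC -scaleNr => e.
  have := @minimal_no_relation (fun t => if t == i' then u 0 i else
     if t == i then - u 0 i' else 0) _ i'; rewrite eqxx => h.
  move: ui0; rewrite h ?eqxx //.
  rewrite (bigD1 i') //= (bigD1 i) 1?eq_sym //= big1 ?addr0.
    by rewrite eqxx (eq_sym i) (negPf ii') eqxx.
  by move=> t /andP [/negPf -> /negPf ->]; rewrite scale0r.
have only t : t = i by apply/eqP; move: no; rewrite negb_exists => /forallP/(_ t)/negPn.
have qi0 : q 0 i != 0.
  by apply/eqP => qi; apply: (qmin (i := i)); rewrite qi; apply: ideal_gen0.
apply: (lmin (j := j0)); exists 0; first by rewrite mxE.
apply/matrixP => t s; rewrite mulmx0 !mxE (only t).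
have := mul_syzygies lsyz; move/matrixP/(_ 0 j0); rewrite !mxE (bigD1 i) //= big1.
  by rewrite addr0 => /eqP; rewrite mulf_eq0 (negPf qi0) => /eqP.
by move=> t' /negP []; rewrite (only t').
Qed.

Lemma linear_dual (j0 : 'I_n) : exists lam : 'I_m -> 'I_n -> 'I_r -> k,
  forall i i', \sum_j \sum_s (l i j)@_U_(s) * lam i' j s = (i == i')%:R.
Proof.
pose T : finType := ('I_n * 'I_r)%type.
pose G : 'M[k]_(m, #|T|) :=
  \matrix_(i < m, x < #|T|) (l i (@enum_val T T x).1)@_U_((@enum_val T T x).2).
have [|X GX] := @row_independent_right_inverse _ G.
  move=> u uG; apply: (no_constant_row j0) => j.
  have lin : \sum_i u 0 i *: l i j \is 1.-homog.
    by apply: rpred_sum => i _; apply: rpredZ.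
  rewrite (homog1E lin) big1 // => s _.
  move/matrixP/(_ 0 (enum_rank ((j, s) : T))): uG; rewrite !mxE => e.
  rewrite [X in X *: _](_ : _ = 0) ?scale0r // raddf_sum -[RHS]e /=.
  by apply: eq_bigr => i _; rewrite mcoeffZ !mxE enum_rankK.
exists (fun i' j s => X (enum_rank ((j, s) : T)) i') => i i'.
move/matrixP/(_ i i'): GX; rewrite !mxE => <-.
rewrite pair_bigA (reindex (@enum_val T T)) /=; last first.
  by apply: onW_bij; apply: enum_val_bij.
by apply: eq_bigr => x _; rewrite mxE -surjective_pairing enum_valK.
Qed.

End Eliminate.

Section Substitution.
Variables (k : fieldType) (r m n : nat).
Local Notation nv := (nvars r m n).
Local Notation P := {mpoly k[nv]}.
Local Notation C := {mpoly k[m * r]}.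
Variables (delta : 'rV[C]_m) (nu : 'M[C]_(m, n)).

(** The substitution c -> c, d -> delta(c), n -> nu(c). *)
Definition elim_tuple : nv.-tuple C :=
  [tuple match split (v : 'I_(m * r + (m + m * n))) with
         | inl w => 'X_w
         | inr w => match split w with
                    | inl i => delta 0 i
                    | inr ij => mxvec nu 0 ij
                    end
         end | v < nv].

Lemma elim_c v : cvar k n v \mPo elim_tuple = 'X_v.
Proof. by rewrite comp_mpolyXU -tnth_nth tnth_mktuple (unsplitK (inl v)). Qed.

Lemma elim_d i : Dmx k r m n 0 i \mPo elim_tuple = delta 0 i.
Proof.
rewrite mxE comp_mpolyXU -tnth_nth tnth_mktuple (unsplitK (inr _)).
by rewrite (unsplitK (inl i)).
Qed.

Lemma elim_n i j : Nmx k r m n i j \mPo elim_tuple = nu i j.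
Proof.
rewrite mxE comp_mpolyXU -tnth_nth tnth_mktuple (unsplitK (inr _)).
by rewrite (unsplitK (inr _)) mxvecE.
Qed.

Lemma elim_embed (p : C) : embed_c n p \mPo elim_tuple = p.
Proof.
pose tc := [tuple cvar k n v | v < m * r].
pose f : {lrmorphism C -> C} := comp_mpoly elim_tuple \o comp_mpoly tc.
pose g : {lrmorphism C -> C} := idfun.
apply: (@lrmorphism_ext _ _ _ f g) => v /=.
by rewrite comp_mpolyXU -tnth_nth tnth_mktuple elim_c.
Qed.

End Substitution.

Section Generators.
Variables (k : fieldType) (r m n : nat).
Variables (q : 'rV[{mpoly k[r]}]_m) (l : 'M[{mpoly k[r]}]_(m, n)).
Local Notation nv := (nvars r m n).
Local Notation P := {mpoly k[nv]}.
Local Notation C := {mpoly k[m * r]}.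

Lemma linear_coef j mon : ((deformed_product q l 0 j)`_1)@_mon =
  \sum_i (q 0 i)@_mon *: Nmx k r m n i j - embed_c n (c_form l j mon).
Proof.
rewrite deformed_product_coef addmxE oppmxE mcoeffB.
by congr (_ - _); [exact: qN_coef | exact: zCl_coef].
Qed.

Lemma quadratic_coef j mon : ((deformed_product q l 0 j)`_2)@_mon =
  - (\sum_i \sum_t (U_(t)%MM == mon)%:R *:
       (embed_c n 'X_(mxvec_index i t) * Nmx k r m n i j)
     + \sum_i (l i j)@_mon *: Dmx k r m n 0 i).
Proof.
rewrite deformed_product_coef mcoeffN addmxE mcoeffD; congr (- (_ + _)).
  exact: zCN_coef.
exact: Dl_coef.
Qed.

Definition relation12 (p : P) := relation q l 1 p \/ relation q l 2 p.

Hypothesis char0 : [pchar k] =i pred0.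
Hypothesis q2 : forall i, q 0 i \is 2.-homog.
Hypothesis l1 : forall i j, l i j \is 1.-homog.
Hypothesis lsyz : generates_syzygies q l.

(** The only relations outside the first two orders are those of D N,
    settled by [cubic_relations_redundant]. *)
Lemma relations_quadratic e p : relation q l e p -> ideal_gen relation12 p.
Proof.
have II := ideal_gen_ideal relation12; have [I0 ID IM] := II.
have in1 j mon : ideal_gen relation12 ((deformed_product q l 0 j)`_1)@_mon.
  by apply: mem_ideal_gen; left; exists j, mon.
have in2 j mon : ideal_gen relation12 ((deformed_product q l 0 j)`_2)@_mon.
  by apply: mem_ideal_gen; right; exists j, mon.
move: e => [|[|[|[|e]]]] [j [mon ->]] //.
- by rewrite deformed_product_coef -map_mxM mul_syzygies // !mxE rmorph0 mcoeff0.
- rewrite deformed_product_coef mcoeffN -map_mxM /= mxE.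
  apply: (ideal_opp II); rewrite mcoeffC mulrC; apply: IM.
  apply: (cubic_relations_redundant char0 q2 l1 lsyz II (E := zC k r m n)).
    by move=> i j' mon'; rewrite ord1; have := in1 j' mon'; rewrite deformed_product_coef.
  move=> i j' mon'; rewrite ord1; have := in2 j' mon'.
  by rewrite deformed_product_coef mcoeffN => /(ideal_opp II); rewrite opprK.
- by rewrite deformed_product_coef mcoeff0.
Qed.

Lemma q_relations_quadratic p :
  q_relations q l p <-> ideal_gen relation12 (embed_c n p).
Proof.
split; apply: ideal_gen_sub => x; first by move=> [e]; apply: relations_quadratic.
by move=> [rx|rx]; apply: mem_ideal_gen; [exists 1%N | exists 2%N].
Qed.

Hypothesis qmin : minimal_generators q.
Hypothesis lmin : minimal_columns l.

Lemma c_form_linear j mon : c_form l j mon \is 1.-homog.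
Proof.
apply: rpred_sum => i _; apply: rpred_sum => t _; apply: rpredZ.
by rewrite dhomogX /= mdeg1.
Qed.

(** The functionals dual to q isolate n_ij in the linear relations. *)
Lemma n_elimination : exists nu : 'M[C]_(m, n),
  (forall i j, nu i j \is 1.-homog) /\
  forall i j, ideal_gen (relation q l 1) (Nmx k r m n i j - embed_c n (nu i j)).
Proof.
have [lam lamE] := quadric_dual q2 qmin.
pose nu : 'M[C]_(m, n) :=
  \matrix_(i, j) \sum_(mon : 'X_{1..r < 3}) lam i mon *: c_form l j mon.
have nuE i j : nu i j = \sum_(mon : 'X_{1..r < 3}) lam i mon *: c_form l j mon.
  by rewrite mxE.
exists nu; split=> i j; rewrite nuE.
  by apply: rpred_sum => mon _; apply/rpredZ/c_form_linear.
have -> : Nmx k r m n i j -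
    embed_c n (\sum_(mon : 'X_{1..r < 3}) lam i mon *: c_form l j mon) =
  \sum_(mon : 'X_{1..r < 3}) (lam i mon)%:MP *
    (\sum_i' (q 0 i')@_mon *: Nmx k r m n i' j - embed_c n (c_form l j mon)).
  under [RHS]eq_bigr => mon _ do rewrite mul_mpolyC scalerBr scaler_sumr.
  rewrite sumrB exchange_big; congr (_ - _); last first.
    rewrite /embed_c raddf_sum; apply: eq_bigr => mon _.
    by rewrite /= comp_mpolyZ.
  under eq_bigr => i' _ do under eq_bigr => mon _ do rewrite scalerA mulrC.
  under eq_bigr => i' _ do rewrite -scaler_suml lamE.
  rewrite (bigD1 i) //= eqxx scale1r big1 ?addr0 // => i' /negPf ->.
  by rewrite scale0r.
apply: (ideal_sum (ideal_gen_ideal _)) => mon _.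
by apply/ideal_genM/mem_ideal_gen; exists j, mon; rewrite linear_coef.
Qed.

(** The functionals dual to the rows of l isolate d_i in the quadratic
    relations; the remaining terms c n are quadratic in c once n is replaced.
    The index j reflects that without columns of l there is no relation
    at all. *)
Lemma d_elimination (nu : 'M[C]_(m, n)) :
  (forall i j, nu i j \is 1.-homog) ->
  (forall i j, ideal_gen (relation q l 1) (Nmx k r m n i j - embed_c n (nu i j))) ->
  exists delta : 'rV[C]_m, (forall i, delta 0 i \is 2.-homog) /\
  forall (j : 'I_n) i, ideal_gen relation12 (Dmx k r m n 0 i - embed_c n (delta 0 i)).
Proof.
move=> nu1 nuE.
have [j0|no] := pickP 'I_n; last first.
  by exists 0; split=> [i|j]; [rewrite mxE; apply: rpred0 | have := no j].
move=> _; have [lam lamE] := linear_dual l1 qmin lsyz lmin j0.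
pose cn j s : C := \sum_i 'X_(mxvec_index i s) * nu i j.
pose rel2 j s := \sum_i embed_c n 'X_(mxvec_index i s) * Nmx k r m n i j
         + \sum_i (l i j)@_U_(s) *: Dmx k r m n 0 i.
have rel2J j s : ideal_gen relation12 (rel2 j s).
  rewrite -[rel2 j s]opprK; apply: (ideal_opp (ideal_gen_ideal _)).
  apply: mem_ideal_gen; right; exists j, U_(s)%MM.
  rewrite quadratic_coef; congr (- (_ + _)); apply: eq_bigr => i _.
  rewrite (bigD1 s) //= eqxx scale1r big1 ?addr0 // => t ts.
  by rewrite eq_mnm1 (negPf ts) scale0r.
pose delta : 'rV[C]_m := \row_i - \sum_j \sum_s lam i j s *: cn j s.
have deltaE i : delta 0 i = - \sum_j \sum_s lam i j s *: cn j s by rewrite mxE.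
exists delta; split=> [i|_ i]; rewrite deltaE.
  rewrite rpredN; apply: rpred_sum => j _; apply: rpred_sum => s _.
  apply: rpredZ; apply: rpred_sum => i' _.
  by apply: (@dhomogM _ _ _ 1 _ 1) => //; rewrite dhomogX /= mdeg1.
have inner j s : rel2 j s - \sum_i' embed_c n 'X_(mxvec_index i' s) *
      (Nmx k r m n i' j - embed_c n (nu i' j)) =
    embed_c n (cn j s) + \sum_i' (l i' j)@_U_(s) *: Dmx k r m n 0 i'.
  rewrite /rel2 addrAC -sumrB; congr (_ + _).
  rewrite /embed_c /cn [RHS]raddf_sum.
  by apply: eq_bigr => i' _ /=; rewrite mulrBr opprB addrC subrK -rmorphM.
have -> : Dmx k r m n 0 i - embed_c n (- \sum_j \sum_s lam i j s *: cn j s) =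
  \sum_j \sum_s (lam i j s)%:MP * (rel2 j s -
    \sum_i' embed_c n 'X_(mxvec_index i' s) *
       (Nmx k r m n i' j - embed_c n (nu i' j))).
  under [RHS]eq_bigr => j _ do under eq_bigr => s _ do
    rewrite inner mul_mpolyC scalerDr scaler_sumr.
  under [RHS]eq_bigr => j _ do rewrite big_split exchange_big /=.
  rewrite big_split [X in _ = _ + X]exchange_big addrC /=; congr (_ + _).
    rewrite /embed_c -raddfN opprK raddf_sum; apply: eq_bigr => j _.
    rewrite raddf_sum; apply: eq_bigr => s _.
    by rewrite /= comp_mpolyZ.
  have collapse i' : \sum_j \sum_s lam i j s *: ((l i' j)@_U_(s) *: Dmx k r m n 0 i')
      = (i' == i)%:R *: Dmx k r m n 0 i'.
    rewrite -lamE scaler_suml; apply: eq_bigr => j _.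
    by rewrite scaler_suml; apply: eq_bigr => s _; rewrite scalerA mulrC.
  under [RHS]eq_bigr => i' _ do rewrite collapse.
  rewrite (bigD1 i) //= eqxx scale1r big1 ?addr0 // => i' /negPf ->.
  by rewrite scale0r.
apply: (ideal_sum (ideal_gen_ideal _)) => j _.
apply: (ideal_sum (ideal_gen_ideal _)) => s _; apply: ideal_genM.
apply: ideal_genD; first exact: rel2J.
apply: (ideal_opp (ideal_gen_ideal _)).
apply: (ideal_sum (ideal_gen_ideal _)) => i' _; apply: ideal_genM.
by apply: ideal_gen_sub (nuE i' j) => x rx; apply: mem_ideal_gen; left.
Qed.

End Generators.

(** * Generation by quadrics *)

Section Quadrics.
Variables (k : fieldType) (r m n : nat).
Variables (q : 'rV[{mpoly k[r]}]_m) (l : 'M[{mpoly k[r]}]_(m, n)).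
Local Notation C := {mpoly k[m * r]}.
Variables (delta : 'rV[C]_m) (nu : 'M[C]_(m, n)).
Hypothesis nu1 : forall i j, nu i j \is 1.-homog.
Hypothesis nuE : forall i j,
  ideal_gen (relation q l 1) (Nmx k r m n i j - embed_c n (nu i j)).
Hypothesis delta2 : forall i, delta 0 i \is 2.-homog.
Hypothesis deltaE : forall (j : 'I_n) i,
  ideal_gen (relation12 q l) (Dmx k r m n 0 i - embed_c n (delta 0 i)).

Let psi := @comp_mpoly _ _ _ (elim_tuple delta nu).

Lemma linear_relation_elim x : relation q l 1 x -> linear_relation q l (psi x).
Proof.
move=> rx; have [j [mon xE]] := rx; rewrite linear_coef in xE.
have psiE : psi x = \sum_i (q 0 i)@_mon *: nu i j - c_form l j mon.
  rewrite xE /psi raddfB /= elim_embed raddf_sum; congr (_ - _).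
  by apply: eq_bigr => i _; rewrite /= comp_mpolyZ elim_n.
split; rewrite psiE.
  apply: rpredB; last exact: c_form_linear.
  by apply: rpred_sum => i _; apply/rpredZ/nu1.
have -> : embed_c n (\sum_i (q 0 i)@_mon *: nu i j - c_form l j mon) =
    x - \sum_i ((q 0 i)@_mon)%:MP * (Nmx k r m n i j - embed_c n (nu i j)).
  under [in RHS]eq_bigr => i _ do rewrite mul_mpolyC scalerBr.
  rewrite sumrB xE opprB [RHS]addrC [RHS]addrA subrK /embed_c raddfB /=; congr (_ - _).
  by rewrite raddf_sum; apply: eq_bigr => i _; rewrite /= comp_mpolyZ.
have II := ideal_gen_ideal (relation q l 1).
apply: ideal_genD; first exact: mem_ideal_gen.
apply: (ideal_opp II); apply: (ideal_sum II) => i _; exact: ideal_genM.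
Qed.

Lemma quadratic_relation_elim x : relation q l 2 x ->
  psi x \is 2.-homog /\ ideal_gen (relation12 q l) (embed_c n (psi x)).
Proof.
move=> rx; have [j [mon xE]] := rx; rewrite quadratic_coef in xE.
pose b (t : 'I_r) : k := (U_(t)%MM == mon)%:R.
have psiE : psi x = - (\sum_i \sum_t b t *: ('X_(mxvec_index i t) * nu i j)
     + \sum_i (l i j)@_mon *: delta 0 i).
  rewrite xE /psi raddfN raddfD !raddf_sum /=; congr (- (_ + _)).
    apply: eq_bigr => i _; rewrite raddf_sum; apply: eq_bigr => t _ /=.
    by rewrite comp_mpolyZ rmorphM /= elim_embed elim_n.
  by apply: eq_bigr => i _; rewrite /= comp_mpolyZ elim_d.
have II := ideal_gen_ideal (relation12 q l).
split; rewrite psiE.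
  rewrite rpredN; apply: rpredD.
    apply: rpred_sum => i _; apply: rpred_sum => t _; apply: rpredZ.
    by apply: (@dhomogM _ _ _ 1 _ 1) => //; rewrite dhomogX /= mdeg1.
  by apply: rpred_sum => i _; apply/rpredZ/delta2.
have embedE : embed_c n (- (\sum_i \sum_t b t *: ('X_(mxvec_index i t) * nu i j)
     + \sum_i (l i j)@_mon *: delta 0 i)) =
   - (\sum_i \sum_t b t *: (embed_c n 'X_(mxvec_index i t) * embed_c n (nu i j))
     + \sum_i (l i j)@_mon *: embed_c n (delta 0 i)).
  rewrite /embed_c raddfN raddfD; congr (- (_ + _)); rewrite raddf_sum /=;
    apply: eq_bigr => i _; last by rewrite comp_mpolyZ.
  rewrite raddf_sum; apply: eq_bigr => t _ /=.
  by rewrite comp_mpolyZ rmorphM.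
have -> : embed_c n (- (\sum_i \sum_t b t *: ('X_(mxvec_index i t) * nu i j)
     + \sum_i (l i j)@_mon *: delta 0 i)) = x
   + \sum_i \sum_t (b t *: embed_c n 'X_(mxvec_index i t))
       * (Nmx k r m n i j - embed_c n (nu i j))
   + \sum_i ((l i j)@_mon)%:MP * (Dmx k r m n 0 i - embed_c n (delta 0 i)).
  rewrite embedE xE; move: (@embed_c k r m n) => ec.
  rewrite !opprD -[RHS]addrA [RHS]addrACA; congr (_ + _); last first.
    rewrite -!sumrN -big_split; apply: eq_bigr => i _ /=.
    by rewrite mul_mpolyC scalerBr addKr.
  rewrite -!sumrN -big_split; apply: eq_bigr => i _ /=.
  rewrite -!sumrN -big_split; apply: eq_bigr => t _ /=.
  by rewrite mulrBr -!scalerAl addKr.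
apply: ideal_genD; first apply: ideal_genD.
- by apply: mem_ideal_gen; right.
- apply: (ideal_sum II) => i _; apply: (ideal_sum II) => t _; apply: ideal_genM.
  by apply: ideal_gen_sub (nuE i j) => y ry; apply: mem_ideal_gen; left.
- by apply: (ideal_sum II) => i _; apply/ideal_genM/deltaE.
Qed.

Hypothesis char0 : [pchar k] =i pred0.
Hypothesis q2 : forall i, q 0 i \is 2.-homog.
Hypothesis l1 : forall i j, l i j \is 1.-homog.
Hypothesis lsyz : generates_syzygies q l.

Lemma q_relations_ideal : is_ideal (q_relations q l).
Proof.
split=> [|x y|a x]; rewrite /q_relations /embed_c.
- by rewrite raddf0; apply: ideal_gen0.
- by rewrite raddfD; apply: ideal_genD.
- by rewrite rmorphM; apply: ideal_genM.
Qed.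

(** Substitution sends each generator to a polynomial congruent to it and
    fixes the c's, so it computes the contraction to k[c]. *)
Lemma q_relationsE p : q_relations q l p <->
  ideal_gen (fun g => exists2 x, relation12 q l x & g = psi x) p.
Proof.
split=> [|pJ].
  move/(q_relations_quadratic char0 q2 l1 lsyz) => pJ.
  rewrite -(elim_embed delta nu p); apply: ideal_gen_map pJ => x rx.
  by apply: mem_ideal_gen; exists x.
apply: ideal_gen_min pJ; first exact: q_relations_ideal.
move=> _ [x rx ->]; apply/(q_relations_quadratic char0 q2 l1 lsyz).
case: rx => [/linear_relation_elim [_]|/quadratic_relation_elim [] //].
by apply: ideal_gen_sub => y ry; apply: mem_ideal_gen; left.
Qed.

Lemma elimination_surjective s (kept : 'I_s -> 'I_(m * r))
    (sub : (m * r).-tuple {mpoly k[s]}) :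
  (forall t, tnth sub (kept t) = 'X_t) ->
  forall a, (a \mPo [tuple 'X_(kept t) | t < s]) \mPo sub = a.
Proof.
move=> subK; pose tc : s.-tuple C := [tuple 'X_(kept t) | t < s].
pose f : {lrmorphism {mpoly k[s]} -> {mpoly k[s]}} := comp_mpoly sub \o comp_mpoly tc.
pose g : {lrmorphism {mpoly k[s]} -> {mpoly k[s]}} := idfun.
apply: (@lrmorphism_ext _ _ _ f g) => v /=.
by rewrite comp_mpolyXU -tnth_nth tnth_mktuple comp_mpolyXU -tnth_nth.
Qed.

(** The substituted linear relations are linear relations among the c's and
    disappear; the substituted quadratic relations are the generators. *)
Lemma reduced_generated_by_quadrics s (kept : 'I_s -> 'I_(m * r))
    (sub : (m * r).-tuple {mpoly k[s]}) :
  linear_elimination q l kept sub ->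
  generated_by_quadrics (reduced_q_relations q l sub).
Proof.
move=> [sub1 subK sub0].
exists (fun g => exists2 x, relation q l 2 x & g = psi x \mPo sub).
split=> [_ [x /quadratic_relation_elim [x2 _] ->]|p]; first exact: dhomog_comp.
split=> [[p0 /q_relationsE p0J ->]|].
  apply: (ideal_gen_map (f := comp_mpoly sub)) p0J => _ [x [rx|rx] ->].
    have lx := linear_relation_elim rx.
    by have /(sub0 _ (proj1 lx)) /= -> := lx; apply: ideal_gen0.
  by apply: mem_ideal_gen; exists x.
have [I0 ID IM] := q_relations_ideal.
apply: ideal_gen_min.
  split=> [|_ _ [x Ix ->] [y Iy ->]|a _ [x Ix ->]].
  - by exists 0 => //; rewrite raddf0.
  - by exists (x + y); [apply: ID | rewrite raddfD].
  - pose tc : s.-tuple C := [tuple 'X_(kept t) | t < s].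
    exists ((a \mPo tc) * x); first exact: IM.
    by rewrite rmorphM /= (elimination_surjective subK).
move=> _ [x rx ->]; exists (psi x) => //; apply/q_relationsE/mem_ideal_gen.
by exists x => //; right.
Qed.

End Quadrics.

(** * Linear changes of variables *)

(** With [change_tupleK], this lets membership of coefficients be tested after
    a linear change of z. *)
Lemma coefs_in_comp (k : fieldType) (N r : nat) (I : {mpoly k[N]} -> Prop)
    (t : r.-tuple {mpoly {mpoly k[N]}[r]}) x :
  is_ideal I -> coefs_in I x -> coefs_in I (x \mPo t).
Proof.
move=> II Ix; have SI := coefs_in_ideal r II.
rewrite comp_mpolyEX; apply: (ideal_sum SI) => mon _.
rewrite -mul_mpolyC mulrC; case: (SI) => _ _; apply => mon'.
rewrite mcoeffC mulrC; case: II => _ _; apply; exact: Ix.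
Qed.

Lemma mcoeffM_linear (k : fieldType) (r : nat) (p a : {mpoly k[r]}) t :
  p \is 1.-homog -> (p * a)@_U_(t) = p@_U_(t) * a@_0%MM.
Proof.
move=> p1.
have U (x : {mpoly k[r]}) : x@_U_(t) = (x^`M(t))@_0%MM.
  by rewrite mcoeff_deriv mnm0E mulr1n add0m.
rewrite !U mderivM mcoeffD !rmorphM /= [p@_0](dhomog_nemf_coeff p1) ?mf0 //.
by rewrite mul0r addr0.
Qed.

Definition change_tuple (K : comNzRingType) (r : nat) (A : 'M[K]_r) :
  r.-tuple {mpoly K[r]} := [tuple \sum_(j < r) A i j *: 'X_j | i < r].

Lemma change_tupleX (K : comNzRingType) (r : nat) (A : 'M[K]_r) i :
  'X_i \mPo change_tuple A = \sum_(j < r) A i j *: 'X_j.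
Proof. by rewrite comp_mpolyXU -tnth_nth tnth_mktuple. Qed.

Lemma change_tupleK (K : comNzRingType) (r : nat) (A B : 'M[K]_r) :
  A *m B = 1%:M -> forall x, (x \mPo change_tuple A) \mPo change_tuple B = x.
Proof.
move=> AB; pose T := {mpoly K[r]}.
pose f : {rmorphism T -> T} := comp_mpoly (change_tuple B) \o
  comp_mpoly (change_tuple A).
pose g : {rmorphism T -> T} := idfun.
apply: (mpoly_rmorphism_ext (f := f) (g := g)) => [a|v] /=.
  by rewrite !comp_mpolyC.
rewrite change_tupleX raddf_sum /=.
under eq_bigr => j _ do rewrite comp_mpolyZ change_tupleX scaler_sumr.
rewrite exchange_big /=.
under eq_bigr => s _ do under eq_bigr => j _ do rewrite scalerA.
under eq_bigr => s _ do rewrite -scaler_suml.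
have sumE s : \sum_j A v j * B j s = (v == s)%:R.
  by have /matrixP/(_ v s) := AB; rewrite !mxE.
under eq_bigr => s _ do rewrite sumE.
rewrite (bigD1 v) //= eqxx scale1r big1 ?addr0 // => s sv.
by rewrite eq_sym (negPf sv) scale0r.
Qed.

Lemma linear_changeK (k : fieldType) (r m : nat) (A : 'M[k]_r)
    (q : 'rV[{mpoly k[r]}]_m) :
  A \in unitmx -> linear_change (invmx A) (linear_change A q) = q.
Proof.
move=> Au; apply/matrixP => i j; rewrite !mxE.
exact: (change_tupleK (mulmxV Au)).
Qed.

Section CoefficientChange.
Variables (k : fieldType) (r m : nat).
Local Notation C := {mpoly k[m * r]}.

(** The substitution C -> B C. *)
Definition c_change (B : 'M[k]_r) : (m * r).-tuple C :=
  [tuple mxvec (\matrix_(i, t) \sum_s B t s *: 'X_(mxvec_index i s)) 0 v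
     | v < m * r].

Lemma c_changeX B i t :
  'X_(mxvec_index i t) \mPo c_change B = \sum_s B t s *: 'X_(mxvec_index i s).
Proof. by rewrite comp_mpolyXU -tnth_nth tnth_mktuple mxvecE mxE. Qed.

Lemma c_changeK (B B' : 'M[k]_r) : B *m B' = 1%:M ->
  forall p, (p \mPo c_change B) \mPo c_change B' = p.
Proof.
move=> BB; pose f : {rmorphism C -> C} := comp_mpoly (c_change B') \o
  comp_mpoly (c_change B).
pose g : {rmorphism C -> C} := idfun.
apply: (mpoly_rmorphism_ext (f := f) (g := g)) => [a|v] /=.
  by rewrite !comp_mpolyC.
case/mxvec_indexP: v => i t.
rewrite c_changeX raddf_sum /=.
under eq_bigr => j _ do rewrite comp_mpolyZ c_changeX scaler_sumr.
rewrite exchange_big /=.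
under eq_bigr => s _ do under eq_bigr => j _ do rewrite scalerA.
under eq_bigr => s _ do rewrite -scaler_suml.
have sumE s : \sum_j B t j * B' j s = (t == s)%:R.
  by have /matrixP/(_ t s) := BB; rewrite !mxE.
under eq_bigr => s _ do rewrite sumE.
rewrite (bigD1 t) //= eqxx scale1r big1 ?addr0 // => s sv.
by rewrite eq_sym (negPf sv) scale0r.
Qed.

Lemma c_change_linear B v : tnth (c_change B) v \is 1.-homog.
Proof.
case/mxvec_indexP: v => i t; rewrite tnth_mktuple mxvecE mxE.
by apply: rpred_sum => s _; apply: rpredZ; rewrite dhomogX /= mdeg1.
Qed.

End CoefficientChange.

Lemma map_mx_mulB (R T : comNzRingType) (f : {rmorphism R -> T}) (m n : nat)
    (Q E : 'rV[R]_m) (N L : 'M[R]_(m, n)) :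
  map_mx f (Q *m N - E *m L) =
  map_mx f Q *m map_mx f N - map_mx f E *m map_mx f L.
Proof. by rewrite map_mxB !map_mxM. Qed.

Lemma map_mx_mulND (R T : comNzRingType) (f : {rmorphism R -> T}) (m n : nat)
    (E D : 'rV[R]_m) (N L : 'M[R]_(m, n)) :
  map_mx f (- (E *m N + D *m L)) =
  - (map_mx f E *m map_mx f N + map_mx f D *m map_mx f L).
Proof. by rewrite map_mxN map_mxD !map_mxM. Qed.

Section Transport.
Variables (k : fieldType) (r m n n' : nat).
Variables (A : 'M[k]_r) (H : 'M[k]_(n', n)).
Variables (q : 'rV[{mpoly k[r]}]_m) (l : 'M[{mpoly k[r]}]_(m, n)).
Variable (l' : 'M[{mpoly k[r]}]_(m, n')).
Hypothesis Au : A \in unitmx.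
Local Notation q' := (linear_change A q).
Local Notation sigma := (comp_mpoly (change_tuple A)).
Hypothesis lH : map_mx sigma l = l' *m map_mx (@mpolyC r k) H.

Local Notation B := (invmx A^T).
Local Notation nv := (nvars r m n).
Local Notation nv' := (nvars r m n').
Local Notation P := {mpoly k[nv]}.
Local Notation P' := {mpoly k[nv']}.

(** The substitution C -> A^-T C, D -> D, N -> N H. *)
Definition full_change : nv.-tuple P' :=
  [tuple match split (v : 'I_(m * r + (m + m * n))) with
         | inl w => embed_c n' (tnth (c_change m B) w)
         | inr w => match split w with
                    | inl i => Dmx k r m n' 0 i
                    | inr ij => mxvec (Nmx k r m n' *m map_mx (@mpolyC nv' k) H) 0 ij
                    end
         end | v < nv].

Let Phi : {rmorphism P -> P'} := comp_mpoly full_change.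

Lemma full_change_c (p : {mpoly k[m * r]}) :
  Phi (embed_c n p) = embed_c n' (p \mPo c_change m B).
Proof.
pose tc := [tuple cvar k n v | v < m * r].
pose tc' := [tuple cvar k n' v | v < m * r].
pose f : {rmorphism {mpoly k[m * r]} -> P'} := Phi \o comp_mpoly tc.
pose g : {rmorphism {mpoly k[m * r]} -> P'} := comp_mpoly tc' \o comp_mpoly (c_change m B).
apply: (mpoly_rmorphism_ext (f := f) (g := g)) => [a|v] /=.
  by rewrite !comp_mpolyC.
rewrite !comp_mpolyXU -!tnth_nth tnth_mktuple comp_mpolyXU -tnth_nth.
by rewrite [LHS]tnth_mktuple (unsplitK (inl v)).
Qed.

Lemma full_change_d : map_mx Phi (Dmx k r m n) = Dmx k r m n'.
Proof.
apply/rowP => i; rewrite mxE [in LHS]mxE /= comp_mpolyXU -tnth_nth tnth_mktuple.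
by rewrite (unsplitK (inr _)) (unsplitK (inl i)).
Qed.

Lemma full_change_n :
  map_mx Phi (Nmx k r m n) = Nmx k r m n' *m map_mx (@mpolyC nv' k) H.
Proof.
apply/matrixP => i j; rewrite mxE [in LHS]mxE /= comp_mpolyXU -tnth_nth tnth_mktuple.
by rewrite (unsplitK (inr _)) (unsplitK (inr _)) mxvecE.
Qed.

Lemma full_change_C :
  map_mx Phi (Cmx k r m n) = map_mx (@mpolyC nv' k) B *m Cmx k r m n'.
Proof.
apply/matrixP => t i; rewrite [LHS]mxE [in LHS]mxE -embed_cX full_change_c c_changeX.
rewrite /embed_c raddf_sum [RHS]mxE; apply: eq_bigr => s _ /=.
by rewrite comp_mpolyZ -/(embed_c n' _) embed_cX !mxE mul_mpolyC.
Qed.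

Local Notation SP := {mpoly P[r]}.
Local Notation SP' := {mpoly P'[r]}.
Local Notation Hh := (map_mx (@mpolyC r _) (map_mx (@mpolyC nv' k) H)).

Let Psi : {rmorphism SP -> SP'} :=
  comp_mpoly (change_tuple (map_mx (@mpolyC nv' k) A)) \o map_mpoly Phi.

Lemma Psi_C p : Psi p%:MP = (Phi p)%:MP.
Proof. by rewrite /= map_mpolyC comp_mpolyC. Qed.

Lemma Psi_X t : Psi 'X_t = \sum_s (A t s)%:MP *: 'X_s.
Proof.
rewrite /= map_mpolyX change_tupleX; apply: eq_bigr => s _.
by rewrite mxE.
Qed.

Lemma Psi_lift f : Psi (lift_z nv f) = lift_z nv' (sigma f).
Proof.
pose F : {rmorphism {mpoly k[r]} -> SP'} := Psi \o lift_z nv.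
pose G : {rmorphism {mpoly k[r]} -> SP'} := lift_z nv' \o sigma.
apply: (mpoly_rmorphism_ext (f := F) (g := G)) => [a|v].
  by rewrite /= comp_mpolyC !map_mpolyC /= !comp_mpolyC.
rewrite /F /G [LHS]/(Psi (lift_z nv 'X_v)) [RHS]/(lift_z nv' (sigma 'X_v)).
rewrite map_mpolyX Psi_X change_tupleX (raddf_sum (map_mpoly (@mpolyC nv' k))); apply: eq_bigr => s _ /=.
by rewrite -[in RHS]mul_mpolyC rmorphM /= map_mpolyC map_mpolyX mul_mpolyC.
Qed.

Lemma Psi_q : map_mx Psi (map_mx (lift_z nv) q) = map_mx (lift_z nv') q'.
Proof.
apply/matrixP => i j; rewrite [LHS]mxE [in LHS]mxE [RHS]mxE [in RHS]mxE.
exact: Psi_lift.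
Qed.

Lemma Psi_l : map_mx Psi (map_mx (lift_z nv) l) = map_mx (lift_z nv') l' *m Hh.
Proof.
have -> : Hh = map_mx (lift_z nv') (map_mx (@mpolyC r k) H).
  by apply/matrixP => i j; rewrite !mxE map_mpolyC.
rewrite -map_mxM -lH; apply/matrixP => i j; rewrite [LHS]mxE [in LHS]mxE Psi_lift.
by rewrite !mxE.
Qed.

Lemma Psi_d : map_mx Psi (map_mx (@mpolyC r _) (Dmx k r m n)) =
  map_mx (@mpolyC r _) (Dmx k r m n').
Proof.
rewrite -full_change_d; apply/matrixP => i j.
by rewrite [LHS]mxE [in LHS]mxE Psi_C [RHS]mxE [in RHS]mxE.
Qed.

Lemma Psi_n : map_mx Psi (map_mx (@mpolyC r _) (Nmx k r m n)) =
  map_mx (@mpolyC r _) (Nmx k r m n') *m Hh.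
Proof.
rewrite -map_mxM -full_change_n; apply/matrixP => i j.
by rewrite [LHS]mxE [in LHS]mxE Psi_C [RHS]mxE [in RHS]mxE.
Qed.

Lemma Psi_zC : map_mx Psi (zC k r m n) = zC k r m n'.
Proof.
rewrite /zC map_mxM.
have -> : map_mx Psi (map_mx (@mpolyC r _) (Cmx k r m n)) =
    map_mx (@mpolyC r _) (map_mx (@mpolyC nv' k) B) *m
    map_mx (@mpolyC r _) (Cmx k r m n').
  rewrite -map_mxM -full_change_C; apply/matrixP => i j.
  by rewrite [LHS]mxE [in LHS]mxE Psi_C [RHS]mxE [in RHS]mxE.
have -> : map_mx Psi (\row_j 'X_j) =
    (\row_j 'X_j) *m map_mx (@mpolyC r _) (map_mx (@mpolyC nv' k) A^T).
  apply/rowP => t; rewrite [LHS]mxE [in LHS]mxE Psi_X [RHS]mxE.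
  by apply: eq_bigr => s _; rewrite !mxE -mul_mpolyC mulrC.
have AB : map_mx (@mpolyC r _) (map_mx (@mpolyC nv' k) A^T) *m
    map_mx (@mpolyC r _) (map_mx (@mpolyC nv' k) B) = 1%:M.
  by rewrite -map_mxM -map_mxM mulmxV ?unitmx_tr // !map_mx1.
rewrite -mulmxA; congr (_ *m _).
by rewrite mulmxA AB mul1mx.
Qed.

(** Psi substitutes z -> Az and [full_change] simultaneously. It carries
    q - zC z_0 - D z_0^2 to its analogue for q', and l + N z_0 to
    (l' + N z_0) H. *)
Lemma Psi_deformed e j : Psi (deformed_product q l 0 j)`_e =
  \sum_s (deformed_product q' l' 0 s)`_e * Hh s j.
Proof.
have main (M : 'rV[SP]_n) (M' : 'rV[SP']_n') : map_mx Psi M = M' *m Hh ->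
    Psi (M 0 j) = \sum_s M' 0 s * Hh s j.
  by move=> /matrixP/(_ 0 j); rewrite [LHS]mxE [RHS]mxE.
under eq_bigr => s _ do rewrite deformed_product_coef.
rewrite deformed_product_coef; case: e => [|[|[|[|e]]]].
- by apply: main; rewrite map_mxM Psi_q Psi_l mulmxA.
- apply: main; rewrite map_mx_mulB Psi_q Psi_l Psi_zC Psi_n.
  by rewrite mulmxBl !mulmxA.
- rewrite -oppmxE; under eq_bigr => s _ do rewrite -oppmxE.
  apply: main; rewrite map_mx_mulND Psi_d Psi_l Psi_zC Psi_n.
  by rewrite mulNmx mulmxDl !mulmxA.
- rewrite -oppmxE; under eq_bigr => s _ do rewrite -oppmxE.
  by apply: main; rewrite map_mxN map_mxM Psi_d Psi_n mulNmx mulmxA.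
- by rewrite rmorph0 big1 // => s _; rewrite mul0r.
Qed.

Lemma relation_change e x :
  relation q l e x -> ideal_gen (relation q' l' e) (Phi x).
Proof.
move=> [j [mon ->]]; set I := ideal_gen _.
have II : is_ideal I by apply: ideal_gen_ideal.
have SI := coefs_in_ideal r II.
have PsiI : coefs_in I (Psi (deformed_product q l 0 j)`_e).
  rewrite Psi_deformed; apply: (ideal_sum SI) => s _; rewrite mulrC.
  case: (SI) => _ _; apply => mon'; apply: mem_ideal_gen.
  by exists s, mon'.
have := coefs_in_comp (change_tuple (map_mx (@mpolyC nv' k) (invmx A))) II PsiI.
rewrite /= change_tupleK; last by rewrite -map_mxM mulmxV // map_mx1.
by move/(_ mon); rewrite mcoeff_map_mpoly.
Qed.

Lemma ideal_change (E : nat -> Prop) (p : {mpoly k[m * r]}) :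
  ideal_gen (fun x => exists2 e, E e & relation q l e x) (embed_c n p) ->
  ideal_gen (fun x => exists2 e, E e & relation q' l' e x)
    (embed_c n' (p \mPo c_change m B)).
Proof.
rewrite -full_change_c; apply: ideal_gen_map => x [e Ee /relation_change].
by apply: ideal_gen_sub => y ry; apply: mem_ideal_gen; exists e.
Qed.

End Transport.

(** The columns of l(Az) are syzygies of q', hence combinations of the columns
    of l'; as both consist of linear forms, only the constant terms of the
    coefficients matter. *)
Lemma syzygy_change (k : fieldType) (r m n n' : nat) (A : 'M[k]_r)
    (q : 'rV[{mpoly k[r]}]_m) (l : 'M[{mpoly k[r]}]_(m, n))
    (l' : 'M[{mpoly k[r]}]_(m, n')) :
  linear_first_syzygy_matrix q l ->
  linear_first_syzygy_matrix (linear_change A q) l' ->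
  exists H : 'M[k]_(n', n),
    map_mx (comp_mpoly (change_tuple A)) l = l' *m map_mx (@mpolyC r k) H.
Proof.
move=> [lsyz _ l1] [lsyz' _ l1'].
have : forall j, exists a : 'cV_n',
    col j (map_mx (comp_mpoly (change_tuple A)) l) = l' *m a.
  move=> j; apply/lsyz'; rewrite -map_col -map_mxM /=.
  have -> : q *m col j l = 0 by rewrite colE mulmxA (mul_syzygies lsyz) mul0mx.
  by rewrite map_mx0.
move/fin_all_exists=> [a aE]; exists (\matrix_(s, j) (a j s 0)@_0%MM).
apply/matrixP => i j; set H := map_mx _ (\matrix_(_, _) _).
have h1 : (map_mx (comp_mpoly (change_tuple A)) l) i j \is 1.-homog.
  rewrite mxE; apply: dhomog_comp => // v; rewrite tnth_mktuple.
  by apply: rpred_sum => s _; apply: rpredZ; rewrite dhomogX /= mdeg1.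
have h2 : (l' *m H) i j \is 1.-homog.
  rewrite mxE; apply: rpred_sum => s _; rewrite [H s j]mxE mulrC mul_mpolyC.
  exact/rpredZ/l1'.
rewrite (homog1E h1) (homog1E h2); apply: eq_bigr => t _; congr (_ *: _).
have := aE j; move/matrixP/(_ i 0); rewrite mxE => ->.
rewrite !mxE !raddf_sum; apply: eq_bigr => s _ /=.
by rewrite !mcoeffM_linear // !mxE mpolyCK.
Qed.

Lemma ideal_transport (k : fieldType) (r m n n' : nat) (A : 'M[k]_r)
    (q : 'rV[{mpoly k[r]}]_m) (l : 'M[{mpoly k[r]}]_(m, n))
    (l' : 'M[{mpoly k[r]}]_(m, n')) : A \in unitmx ->
  linear_first_syzygy_matrix q l ->
  linear_first_syzygy_matrix (linear_change A q) l' ->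
  forall p,
  (q_relations q l p ->
   q_relations (linear_change A q) l' (p \mPo c_change m (invmx A^T))) /\
  (linear_relation q l p ->
   linear_relation (linear_change A q) l' (p \mPo c_change m (invmx A^T))).
Proof.
move=> Au ql q'l' p; have [H lH] := syzygy_change ql q'l'.
split=> [pI|[p1 pI]].
  have : ideal_gen (fun x => exists2 e, True & relation q l e x) (embed_c n p).
    by apply: ideal_gen_sub pI => x [e rx]; apply: mem_ideal_gen; exists e.
  move/(ideal_change Au lH (E := fun=> True)); apply: ideal_gen_sub => x [e _ rx].
  by apply: mem_ideal_gen; exists e.
split; first by apply: dhomog_comp p1 => v; apply: c_change_linear.
have : ideal_gen (fun x => exists2 e, e = 1%N & relation q l e x) (embed_c n p).
  by apply: ideal_gen_sub pI => x rx; apply: mem_ideal_gen; exists 1%N.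
move/(ideal_change Au lH (E := fun e => e = 1%N)).
by apply: ideal_gen_sub => x [e -> rx]; apply: mem_ideal_gen.
Qed.

(** A substitution preserving linear relations descends to the reduced
    coordinates: c_v and the linear form that replaces it differ by a linear
    relation. *)
Lemma reduced_factor (k : fieldType) (r m n n' s s' : nat)
    (q q' : 'rV[{mpoly k[r]}]_m) (l : 'M[{mpoly k[r]}]_(m, n))
    (l' : 'M[{mpoly k[r]}]_(m, n')) (t : (m * r).-tuple {mpoly k[m * r]})
    (kept : 'I_s -> 'I_(m * r)) (kept' : 'I_s' -> 'I_(m * r))
    (sub : (m * r).-tuple {mpoly k[s]}) (sub' : (m * r).-tuple {mpoly k[s']}) :
  (forall p, linear_relation q l p -> linear_relation q' l' (p \mPo t)) ->
  linear_elimination q l kept sub -> linear_elimination q' l' kept' sub' ->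
  exists g : {lrmorphism {mpoly k[s]} -> {mpoly k[s']}},
    forall p, g (p \mPo sub) = (p \mPo t) \mPo sub'.
Proof.
move=> lin [sub1 subK sub0] [_ _ sub0'].
pose C := {mpoly k[m * r]}; pose S := {mpoly k[s]}; pose S' := {mpoly k[s']}.
pose tk : s.-tuple C := [tuple 'X_(kept v) | v < s].
pose f : {lrmorphism C -> S'} := comp_mpoly sub' \o comp_mpoly t.
pose g : {lrmorphism S -> S'} := f \o comp_mpoly tk.
exists g => p.
pose gs : {lrmorphism C -> S'} := g \o comp_mpoly sub.
apply: (@lrmorphism_ext _ _ _ gs f) => v.
rewrite /gs /= comp_mpolyXU -tnth_nth.
(* the linear relation that eliminates c_v *)
pose d : C := 'X_v - (tnth sub v \mPo tk).
have d1 : d \is 1.-homog.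
  apply: rpredB; first by rewrite dhomogX /= mdeg1.
  by apply: dhomog_comp => // w; rewrite tnth_mktuple dhomogX /= mdeg1.
have ds : d \mPo sub = 0.
  by rewrite raddfB /= (elimination_surjective subK) comp_mpolyXU -tnth_nth subrr.
have [d1' ld] := lin _ ((sub0 _ d1).1 ds).
have /eqP := (sub0' _ d1').2 (conj d1' ld).
by rewrite !raddfB subr_eq0 => /eqP ->.
Qed.

Theorem proposition2p8
    (k : closedFieldType) (char0 : [pchar k] =i pred0)
    (r m n : nat) (r_ge2 : (2 <= r)%N)
    (q : 'rV[{mpoly k[r]}]_m) (l : 'M[{mpoly k[r]}]_(m, n))
    (q_quadratic : forall i, q 0 i \is 2.-homog)
    (q_minimal : minimal_generators q)
    (q_codim : codimension (ideal_of_row q) r)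
    (l_syz : linear_first_syzygy_matrix q l) :
  (forall (s : nat) (kept : 'I_s -> 'I_(m * r))
          (sub : (m * r).-tuple {mpoly k[s]}),
     linear_elimination q l kept sub ->
     generated_by_quadrics (reduced_q_relations q l sub)) /\
  (forall (A : 'M[k]_r) (n' : nat) (l' : 'M[{mpoly k[r]}]_(m, n')),
     A \in unitmx ->
     linear_first_syzygy_matrix (linear_change A q) l' ->
     ideal_iso (q_relations q l) (q_relations (linear_change A q) l') /\
     forall (s s' : nat)
            (kept : 'I_s -> 'I_(m * r)) (kept' : 'I_s' -> 'I_(m * r))
            (sub : (m * r).-tuple {mpoly k[s]})
            (sub' : (m * r).-tuple {mpoly k[s']}),
       linear_elimination q l kept sub ->
       linear_elimination (linear_change A q) l' kept' sub' ->
       ideal_iso (reduced_q_relations q l sub)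
                 (reduced_q_relations (linear_change A q) l' sub')).
Proof.
have [lsyz lmin l1] := l_syz; split.
  have [nu [nu1 nuE]] := n_elimination l q_quadratic q_minimal.
  have [delta [delta2 deltaE]] := d_elimination l1 lsyz q_minimal lmin nu1 nuE.
  move=> s kept sub.
  exact: (reduced_generated_by_quadrics nu1 nuE delta2 deltaE).
move=> A n' l' Au l'_syz; set q' := linear_change A q.
pose B := invmx A^T; pose B' := invmx (invmx A)^T.
have B'E : B' = A^T by rewrite /B' trmx_inv invmxK.
have Atu : A^T \in unitmx by rewrite unitmx_tr.
have BB' : B *m B' = 1%:M by rewrite B'E mulVmx.
have B'B : B' *m B = 1%:M by rewrite B'E mulmxV.
have forth := ideal_transport Au l_syz l'_syz.
have back p : (q_relations q' l' p -> q_relations q l (p \mPo c_change m B')) /\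
    (linear_relation q' l' p -> linear_relation q l (p \mPo c_change m B')).
  have := @ideal_transport _ _ _ _ _ (invmx A) q' l' l.
  by rewrite linear_changeK // unitmx_inv; apply.
split.
  exists (comp_mpoly (c_change m B)); split.
    by exists (comp_mpoly (c_change m B')); apply: c_changeK.
  move=> p; split; first exact: (proj1 (forth p)).
  by move/(proj1 (back _)); rewrite (c_changeK BB').
move=> s s' kept kept' sub sub' el el'.
have [g gE] := reduced_factor (fun p => proj2 (forth p)) el el'.
have [g' g'E] := reduced_factor (fun p => proj2 (back p)) el' el.
have [_ subK _] := el; have [_ subK' _] := el'.
have gK : cancel g g'.
  by move=> x; rewrite -(elimination_surjective subK x) gE g'E (c_changeK BB').
have g'K : cancel g' g.
  by move=> x; rewrite -(elimination_surjective subK' x) g'E gE (c_changeK B'B).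
exists g; split; first by exists g'.
move=> p; split=> [[p0 p0I ->]|[p0 p0I gp]].
  by exists (p0 \mPo c_change m B); [apply: (proj1 (forth p0)) | rewrite gE].
exists (p0 \mPo c_change m B'); first exact: (proj1 (back p0)).
by rewrite -g'E -gp gK.
Qed.
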